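(* For any integer $d\ge0$, the assignment $w\text{-}\mathrm{PD}_d:\mathrm{WFil}\to\mathrm{WDgm}$, $w\text{-}F\mapsto w\text{-}\mathrm{PD}_d^F$, is a functor, where a morphism $(f,g,Z,\pi_V,\pi_W)$ of $\mathrm{WFil}$ is sent to the Galois connection $f:Q\leftrightarrows R:g$. Moreover, for every $p\in[1,\infty]$ and all weighted filtrations $w\text{-}F$, $w\text{-}G$, $$d^{E,p}_{\mathrm{WDgm}}(w\text{-}\mathrm{PD}_d^F,w\text{-}\mathrm{PD}_d^G)\le4^{\frac1p}\cdot d^{E,p}_{\mathrm{WFil}}(w\text{-}F,w\text{-}G)$$ (with $\frac1p=0$ for $p=\infty$).
   Context: **Galois connections and intervals.** A Galois connection $f:Q\leftrightarrows R:g$ is a pair of order-preserving maps with $f(q)\le r\iff q\le g(r)$. For a poset $Q$, $\bar Q=\{[q_1,q_2]:q_1\le q_2\}$ with the product order, $\mathrm{diag}(\bar Q)=\{[q,q]:q\in Q\}$, and $\bar f([q_1,q_2])=[f(q_1),f(q_2)]$. **WFil.** A 1-parameter filtration is an order-preserving map $F:Q\to\mathrm{SubCx}(K_V)$ with $Q\subseteq[0,\infty)$ finite, $0\in Q$, $K_V$ a simplicial complex with finite vertex set $V$, $\mathrm{SubCx}(K_V)$ the poset of its subcomplexes, $F(\max Q)=K_V$. A weighted filtration $w\text{-}F$ is a 1-parameter filtration with a probability measure $\mu_Q$ of full support on $Q$. For a finite set $Z$ and a surjection $\pi:Z\to V$, the pullback filtration $F_Z^\pi$ sends $q$ to the smallest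 simplicial complex on $Z$ containing $\{\pi^{-1}(\sigma):\sigma\in F(q)\}$. Objects of $\mathrm{WFil}$: weighted filtrations. A morphism from $(F:Q\to\mathrm{SubCx}(K_V),\mu_Q)$ to $(G:R\to\mathrm{SubCx}(K_W),\mu_R)$ is a tuple $(f,g,Z,\pi_V,\pi_W)$ with $Z$ a finite set, $\pi_V:Z\to V$, $\pi_W:Z\to W$ surjections, $f:Q\leftrightarrows R:g$ a Galois connection, $G_Z^{\pi_W}(r)=F_Z^{\pi_V}(g(r))$ for all $r\in R$, and $f_\#\mu_Q=\mu_R$. Tuples with the same $(f,g)$ whose sets $Z,Z'$ are related by a bijection compatible with the surjections are identified; the composite of $(f,g,Z,\pi_V,\pi_W)$ with $(f',g',Z',\pi'_W,\pi'_U)$ is $(f'\circ f,g\circ g',Z\times_WZ',\pi_V\circ\mathrm{pr}_1,\pi'_U\circ\mathrm{pr}_2)$. $p$-cost: $\big(\sum_{q_1,q_2\in Q}\big||q_1-q_2|-|f(q_1)-f(q_2)|\big|^p\mu_Q(q_1)\mu_Q(q_2)\big)^{1/p}$ for $p<\infty$; $\max_{q_1,q_2}\big||q_1-q_2|-|f(q_1)-f(q_2)|\big|$ for $p=\infty$. **Displacement.** For $I_i=[a_i,b_i]$, $J_i=[c_i,d_i]$ ($i=1,2$), $\mathrm{dpl}(I_1,I_2,J_1,J_2)$ is the maximum of $|(a_1-a_2)-(c_1-c_2)|$, $|(a_1-b_2)-(c_1-d_2)|$, $|(b_1-a_2)-(d_1-c_2)|$, $|(b_1-b_2)-(d_1-d_2)|$.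 **WDgm.** A weighted persistence diagram consists of a finite $Q\subseteq[0,\infty)$ with $0\in Q$, a function $\sigma:\bar Q\to\mathbb N$ and a probability measure $\mu_{\bar Q}$ on $\bar Q$ with $\sigma(I)>0\Rightarrow\mu_{\bar Q}(I)>0$ for $I\in\bar Q\setminus\mathrm{diag}(\bar Q)$. A morphism from $(\sigma,\mu_{\bar Q})$ to $(\tau,\mu_{\bar R})$ is a Galois connection $f:Q\leftrightarrows R:g$ with $\tau(J)=\sum_{\bar f(I)=J}\sigma(I)$ for all $J\in\bar R\setminus\mathrm{diag}(\bar R)$ and $\bar f_\#\mu_{\bar Q}=\mu_{\bar R}$. $p$-cost: $\big(\sum_{I_1,I_2\in\bar Q}\mathrm{dpl}(I_1,I_2,\bar f(I_1),\bar f(I_2))^p\mu_{\bar Q}(I_1)\mu_{\bar Q}(I_2)\big)^{1/p}$ for $p<\infty$; $\max_{I_1,I_2\in\bar Q}\mathrm{dpl}(I_1,I_2,\bar f(I_1),\bar f(I_2))$ for $p=\infty$. **Weighted persistence diagram of a weighted filtration.** Fix a field $\Bbbk$. $\mathrm{ZB}_d^F([q_i,q_j])=\dim(Z_d(F(q_i))\cap B_d(F(q_j)))$, with $Z_d,B_d$ simplicial $d$-cycles and $d$-boundaries over $\Bbbk$ inside the $d$-th chain space of $K_V$; $\mathrm{PD}_d^F:\bar Q\to\mathbb Z$ is its Möbius inverse: $\mathrm{ZB}_d^F(I)=\sum_{I'\le I}\mathrm{PD}_d^F(I')$ for all $I\in\bar Q$ (known to take values in $\mathbb N$). With $\mathrm{flip}:Q\times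 Q\to\bar Q$, $\mathrm{flip}(q_1,q_2)=[\min(q_1,q_2),\max(q_1,q_2)]$, $w\text{-}\mathrm{PD}_d^F$ is $\mathrm{PD}_d^F$ with weight $\mathrm{flip}_\#(\mu_Q\otimes\mu_Q)$. **$p$-edit distance.** $d^{E,p}_{\mathcal C}(A,B)$ is the infimum (with $\inf\emptyset=+\infty$) of the $p$-costs of all finite sequences of morphisms $A\leftrightarrow D_1\leftrightarrow\cdots\leftrightarrow D_{k-1}\leftrightarrow B$ of $\mathcal C$ (each in either direction), the $p$-cost of a sequence being the sum of the $p$-costs of its morphisms. *)

(* Defs.v *)
From HB Require Import structures.
From mathcomp Require Import all_classical all_reals all_analysis.
From mathcomp Require Import all_boot all_order all_algebra finmap.

Set Implicit Arguments.
Unset Strict Implicit.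
Unset Printing Implicit Defensive.

Import Order.TTheory GRing.Theory Num.Theory.
Local Open Scope ring_scope.

(* Finite subsets of the real line are ordered as subsets of the line. *)
HB.instance Definition _ (R : realType) (Q : {fset R}) :=
  [SubChoice_isSubOrder of Q by <: with ring_display].

Section Mobius.
Context {disp : Order.disp_t} {T : finPOrderType disp}.
Implicit Types (h : T -> int) (x y : T).

(* [#|T|] recursive calls are enough to reach the minimal elements. *)
Fixpoint mobius_rec (n : nat) h x : int :=
  h x - (if n is m.+1 then \sum_(y | (y < x)%O) mobius_rec m h y else 0).

Definition mobius_inv h : T -> int := mobius_rec #|T| h.

Lemma mobius_rec_stable h n m x :
  (#|[pred y | (y < x)%O]| <= n)%N -> (#|[pred y | (y < x)%O]| <= m)%N ->
  mobius_rec n h x = mobius_rec m h x.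
Proof.
have no_lt z : #|[pred y | (y < z)%O]| = 0%N ->
    forall l, mobius_rec l h z = h z.
  move=> /eqP /pred0P z0 [|l] /=; first by rewrite subr0.
  by rewrite big_pred0 ?subr0.
elim: n m x => [|n IHn] [|m] x.
- by [].
- by rewrite leqn0 => /eqP x0 _; rewrite !no_lt.
- by move=> _; rewrite leqn0 => /eqP x0; rewrite !no_lt.
move=> ltn ltm /=; congr (_ - _); apply: eq_bigr => y ltyx.
have lt_card : (#|[pred z | (z < y)%O]| < #|[pred z | (z < x)%O]|)%N.
  apply: proper_card; apply/properP; split.
    by apply/subsetP => z; rewrite !inE => /lt_trans; apply.
  by exists y; rewrite !inE ?ltyx // ltxx.
by apply: IHn; rewrite -ltnS; apply: leq_trans lt_card _.
Qed.

Lemma mobius_invE h x : h x = \sum_(y | (y <= x)%O) mobius_inv h y.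
Proof.
rewrite (bigD1 x) //=; under eq_bigl do rewrite andbC -lt_neqAle.
rewrite [mobius_inv h x](@mobius_rec_stable h _ #|T|.+1) ?max_card //=; last first.
  by rewrite ltnW // ltnS max_card.
by rewrite subrK.
Qed.

Lemma mobius_inv_unique h g :
  (forall x, h x = \sum_(y | (y <= x)%O) g y) -> g =1 mobius_inv h.
Proof.
move=> hE x; have [n] := ubnP #|[pred y | (y < x)%O]|.
elim: n x => // n IHn x; rewrite ltnS => lexn.
have := hE x; rewrite mobius_invE (bigD1 x) //= [RHS](bigD1 x) //=.
rewrite [X in _ + X = _](eq_bigr g); first by move/addIr.
move=> y /andP[leyx neyx]; have ltyx : (y < x)%O by rewrite lt_neqAle neyx.
apply/esym/IHn; apply: leq_trans lexn; apply: proper_card; apply/properP; split.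
  by apply/subsetP => z; rewrite !inE => /lt_trans; apply.
by exists y; rewrite !inE ?ltyx // ltxx.
Qed.

End Mobius.

Section Intervals.
Context {disp : Order.disp_t} (Q : finPOrderType disp).

Record ival := Ival { ival_pair : Q *p Q; _ : (ival_pair.1 <= ival_pair.2)%O }.

HB.instance Definition _ := [isSub for ival_pair].
HB.instance Definition _ := [Finite of ival by <:].
HB.instance Definition _ :=
  [SubChoice_isSubPOrder of ival by <: with Order.default_display].

Definition ival_lo (I : ival) : Q := (val I).1.
Definition ival_hi (I : ival) : Q := (val I).2.
Definition ival_diag (I : ival) : bool := ival_lo I == ival_hi I.

Lemma ival_leP (I : ival) : (ival_lo I <= ival_hi I)%O.
Proof. exact: valP I. Qed.

Lemma ival_leE (I J : ival) :
  (I <= J)%O = (ival_lo I <= ival_lo J)%O && (ival_hi I <= ival_hi J)%O.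
Proof. by []. Qed.

End Intervals.

Record galois d1 d2 (Q : finPOrderType d1) (S : finPOrderType d2) := Galois {
  gfun : Q -> S;
  gadj : S -> Q;
  gfun_homo : {homo gfun : x y / (x <= y)%O};
  gadj_homo : {homo gadj : x y / (x <= y)%O};
  galoisP : forall q s, (gfun q <= s)%O = (q <= gadj s)%O }.

Definition galois_id d (Q : finPOrderType d) : galois Q Q :=
  @Galois _ _ Q Q id id (fun _ _ => id) (fun _ _ => id) (fun _ _ => erefl).

Section GaloisComp.
Context {d1 d2 d3 : Order.disp_t}.
Context {Q : finPOrderType d1} {S : finPOrderType d2} {T : finPOrderType d3}.
Variables (f : galois Q S) (h : galois S T).

Fact galois_comp_subproof q t :
  ((gfun h \o gfun f) q <= t)%O = (q <= (gadj f \o gadj h) t)%O.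
Proof. by rewrite /= !galoisP. Qed.

Definition galois_comp : galois Q T :=
  @Galois _ _ Q T (gfun h \o gfun f) (gadj f \o gadj h)
    (fun x y le => gfun_homo h (gfun_homo f le))
    (fun x y le => gadj_homo f (gadj_homo h le))
    galois_comp_subproof.

End GaloisComp.

Definition galois_eq d1 d2 (Q : finPOrderType d1) (S : finPOrderType d2)
  (f h : galois Q S) : Prop := gfun f =1 gfun h /\ gadj f =1 gadj h.

Definition galois_bar d1 d2 (Q : finPOrderType d1) (S : finPOrderType d2)
    (f : galois Q S) (I : ival Q) : ival S :=
  @Ival _ S (gfun f (ival_lo I), gfun f (ival_hi I)) (gfun_homo f (ival_leP I)).

Fact flip_subproof d (Q : finOrderType d) (q : Q * Q) :
  (Order.min q.1 q.2 <= Order.max q.1 q.2)%O.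
Proof. by rewrite le_max ge_min lexx. Qed.

Definition flip d (Q : finOrderType d) (q : Q * Q) : ival Q :=
  @Ival _ Q (Order.min q.1 q.2, Order.max q.1 q.2) (flip_subproof q).

Section FiniteProbability.
Context {R : realType}.

Record fprob (T : finType) := FProb {
  fprob_mass :> T -> R;
  fprob_ge0 : forall x, 0 <= fprob_mass x;
  fprob_sum : \sum_x fprob_mass x = 1 }.

Section Push.
Context {T U : finType} (f : T -> U) (mu : fprob T).

Definition fprob_push_mass (u : U) : R := \sum_(x | f x == u) mu x.

Fact fprob_push_ge0 u : 0 <= fprob_push_mass u.
Proof. by apply: sumr_ge0 => x _; apply: fprob_ge0. Qed.

Fact fprob_push_sum : \sum_u fprob_push_mass u = 1.
Proof. by rewrite -(fprob_sum mu) [RHS](partition_big f xpredT). Qed.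

Definition fprob_push : fprob U := FProb fprob_push_ge0 fprob_push_sum.

End Push.

Section Product.
Context {T U : finType} (mu : fprob T) (nu : fprob U).

Definition fprob_prod_mass (x : T * U) : R := mu x.1 * nu x.2.

Fact fprob_prod_ge0 x : 0 <= fprob_prod_mass x.
Proof. by rewrite mulr_ge0 // fprob_ge0. Qed.

Fact fprob_prod_sum : \sum_x fprob_prod_mass x = 1.
Proof.
rewrite -(pair_bigA _ (fun x y => mu x * nu y)) /= -(fprob_sum mu).
by apply: eq_bigr => x _; rewrite -mulr_sumr fprob_sum mulr1.
Qed.

Definition fprob_prod : fprob (T * U)%type := FProb fprob_prod_ge0 fprob_prod_sum.

End Product.

Lemma fprob_push_id (T : finType) (mu : fprob T) : fprob_push id mu =1 mu.
Proof. by move=> x; rewrite /= /fprob_push_mass big_pred1_eq. Qed.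

Lemma fprob_push_comp (T U W : finType) (f : T -> U) (g : U -> W) (mu : fprob T) :
  fprob_push (g \o f) mu =1 fprob_push g (fprob_push f mu).
Proof.
move=> w; rewrite /= /fprob_push_mass (partition_big f (fun u => g u == w)) //=.
apply: eq_bigr => u /eqP gu; apply: eq_bigl => x /=.
by apply: andb_idl => /eqP ->; rewrite gu.
Qed.

Lemma eq_fprob_push (T U : finType) (f : T -> U) (mu nu : fprob T) :
  mu =1 nu -> fprob_push f mu =1 fprob_push f nu.
Proof. by move=> eq u; apply: eq_bigr => x _; apply: eq. Qed.

(* For [p = +oo] the weight plays no role; [p = -oo] is a dummy case. *)
Definition lp_cost (T : finType) (mu : fprob T) (D : T -> T -> R) (p : \bar R)
    : R :=
  if p is r%:E then
    (\sum_x \sum_y D x y `^ r * mu x * mu y) `^ r^-1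
  else \big[Num.max/0]_x \big[Num.max/0]_y D x y.

End FiniteProbability.
Arguments fprob R T : clear implicits.

Section SimplicialComplexes.
Variable V : finType.

(* The empty face is excluded, and a complex need not use every vertex. *)
Definition is_complex (L : {set {set V}}) : bool :=
  (set0 \notin L) &&
  [forall s in L, forall t : {set V}, (t != set0) && (t \subset s) ==> (t \in L)].

Lemma is_complexP (L : {set {set V}}) :
  reflect (set0 \notin L /\
           forall s t : {set V}, s \in L -> t != set0 -> t \subset s -> t \in L)
          (is_complex L).
Proof.
apply: (iffP andP) => -[L0 Lsub]; split=> //.
  move=> s t sL t0 ts; have /forall_inP/(_ s sL)/forallP/(_ t) := Lsub.
  by rewrite t0 ts.
apply/forall_inP => s sL; apply/forallP => t; apply/implyP => /andP[t0 ts].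
exact: Lsub sL t0 ts.
Qed.

Definition gen_complex (S : {set {set V}}) : {set {set V}} :=
  \bigcap_(L : {set {set V}} | is_complex L && (S \subset L)) L.

End SimplicialComplexes.

Definition pullback (V Z : finType) (pi : Z -> V) (L : {set {set V}}) :
    {set {set Z}} :=
  gen_complex [set pi @^-1: s | s : {set V} in L].

Definition onto (Z V : Type) (pi : Z -> V) : Prop :=
  forall v, exists z, pi z = v.

Lemma in_pullback (V Z : finType) (pi : Z -> V) (L : {set {set V}}) t :
  is_complex L -> onto pi ->
  (t \in pullback pi L) = (t != set0) && (pi @: t \in L).
Proof.
move=> /is_complexP[L0 Lsub] piS.
have preK (s : {set V}) : pi @: (pi @^-1: s) = s.
  apply/setP => v; apply/imsetP/idP => [[z]|vs]; first by rewrite inE => ? ->.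
  by have [z pz] := piS v; exists z; rewrite ?inE pz.
apply/bigcapP/idP => [tin | /andP[t0 tL] M /andP[/is_complexP[_ Msub] LM]].
  pose M := [set t : {set Z} | (t != set0) && (pi @: t \in L)].
  suff MP : is_complex M && ([set pi @^-1: s | s : {set V} in L] \subset M).
    by have := tin M MP; rewrite inE.
  apply/andP; split.
    apply/is_complexP; split=> [|s u]; first by rewrite inE eqxx.
    rewrite !inE => /andP[s0 sL] u0 us; rewrite u0 /=.
    by apply: Lsub sL _ (imsetS _ us); rewrite imset_eq0.
  apply/subsetP => _ /imsetP[s sL ->]; rewrite inE preK sL andbT.
  apply: contraNneq L0 => s0; have <- : s = set0; last by [].
  by rewrite -(preK s) s0 imset0.
apply: (Msub (pi @^-1: (pi @: t))) => //; last first.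
  by apply/subsetP => z zt; rewrite inE imset_f.
by apply: (subsetP LM); rewrite imset_f.
Qed.

Section Homology.
Variables (k : fieldType) (V : finType).

(* A single ambient space carries the chains of all degrees of all complexes  *)
(* on [V]; each simplex is oriented by the canonical enumeration of [V].      *)
Definition chain := {ffun {set V} -> k^o}.

Definition simplex_chain (s : {set V}) : chain := [ffun t => (t == s)%:R].

(* Vertices have zero boundary: the homology is not reduced. *)
Definition simplex_bdry (s : {set V}) : chain :=
  if (#|s| <= 1)%N then 0 else
  \sum_(v in s)
    (-1) ^+ #|[set u in s | (enum_rank u < enum_rank v)%N]|
      *: simplex_chain (s :\ v).

Definition bdry (c : chain) : chain := \sum_(s : {set V}) c s *: simplex_bdry s.

Fact bdry_is_linear : linear bdry.
Proof.
move=> a c e; rewrite /bdry scaler_sumr -big_split; apply: eq_bigr => s _ /=.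
by rewrite !ffunE scalerDl scalerA.
Qed.

HB.instance Definition _ :=
  GRing.isLinear.Build k chain chain _ bdry bdry_is_linear.

Definition chains (d : nat) (L : {set {set V}}) : {vspace chain} :=
  (\sum_(s in L | #|s| == d.+1) <[simplex_chain s]>)%VS.

Definition cycles (d : nat) (L : {set {set V}}) : {vspace chain} :=
  (chains d L :&: lker (linfun bdry))%VS.

Definition boundaries (d : nat) (L : {set {set V}}) : {vspace chain} :=
  (linfun bdry @: chains d.+1 L)%VS.

Lemma chainsS d (L M : {set {set V}}) :
  L \subset M -> (chains d L <= chains d M)%VS.
Proof.
move=> LM; apply/subv_sumP => s /andP[sL sd].
by apply: (sumv_sup s) => //; rewrite (subsetP LM) ?sL.
Qed.

Lemma cyclesS d (L M : {set {set V}}) :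
  L \subset M -> (cycles d L <= cycles d M)%VS.
Proof. by move=> LM; rewrite capvS // chainsS. Qed.

Lemma boundariesS d (L M : {set {set V}}) :
  L \subset M -> (boundaries d L <= boundaries d M)%VS.
Proof. by move=> LM; rewrite limgS // chainsS. Qed.

End Homology.

Section Filtrations.
Variable R : realType.

Record index_set := IndexSet {
  iset :> {fset R};
  index_set_ge0 : forall q, q \in iset -> 0 <= q;
  index_set0 : 0 \in iset }.

Record filtration := Filtration {
  fidx : index_set;
  vert : finType;
  cplx : {set {set vert}};
  cplx_complex : is_complex cplx;
  cplx_vert : forall v : vert, [set v] \in cplx;
  flt : fidx -> {set {set vert}};
  flt_complex : forall q, is_complex (flt q);
  flt_sub : forall q, flt q \subset cplx;
  flt_homo : forall q1 q2, q1 <= q2 -> flt q1 \subset flt q2;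
  flt_max : forall q, (forall q', q' <= q) -> flt q = cplx }.

Arguments flt : clear implicits.

Record wfiltration := WFiltration {
  wflt :> filtration;
  wgt : fprob R (fidx wflt);
  wgt_gt0 : forall q, 0 < wgt q }.

Record wfil_hom (F G : wfiltration) := WFilHom {
  wfil_galois : galois (fidx F) (fidx G);
  wfil_cover : finType;
  piL : wfil_cover -> vert F;
  piR : wfil_cover -> vert G;
  piL_onto : onto piL;
  piR_onto : onto piR;
  wfil_pullback : forall r,
    pullback piR (flt G r) = pullback piL (flt F (gadj wfil_galois r));
  wfil_push : fprob_push (gfun wfil_galois) (wgt F) =1 wgt G }.

Arguments piL {F G} h z : rename.
Arguments piR {F G} h z : rename.
Arguments piL_onto {F G} h v : rename.
Arguments piR_onto {F G} h v : rename.

Definition wfil_eq (F G : wfiltration) (x y : wfil_hom F G) : Prop :=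
  galois_eq (wfil_galois x) (wfil_galois y) /\
  exists b : wfil_cover x -> wfil_cover y,
    [/\ bijective b, forall z, piL y (b z) = piL x z
      & forall z, piR y (b z) = piR x z].

Definition wfil_id (F : wfiltration) : wfil_hom F F :=
  @WFilHom F F (galois_id (fidx F)) (vert F) id id
    (fun v => ex_intro _ v erefl) (fun v => ex_intro _ v erefl)
    (fun r => erefl) (fprob_push_id (wgt F)).

Section WFilComp.
Variables (F G H : wfiltration) (x : wfil_hom F G) (y : wfil_hom G H).

Definition fiber_prod : finType :=
  {z : wfil_cover x * wfil_cover y | piR x z.1 == piL y z.2}.

Let fst_fib (z : fiber_prod) : wfil_cover x := (val z).1.
Let snd_fib (z : fiber_prod) : wfil_cover y := (val z).2.

Fact fst_fib_onto : onto fst_fib.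
Proof.
move=> z; have [z' /esym/eqP zz'] := piL_onto y (piR x z).
by exists (exist _ (z, z') zz').
Qed.

Fact snd_fib_onto : onto snd_fib.
Proof.
move=> z'; have [z /eqP zz'] := piR_onto x (piL y z').
by exists (exist _ (z, z') zz').
Qed.

Fact wfil_comp_piL_onto : onto (piL x \o fst_fib).
Proof.
by move=> v; have [z <-] := piL_onto x v; have [w <-] := fst_fib_onto z; exists w.
Qed.

Fact wfil_comp_piR_onto : onto (piR y \o snd_fib).
Proof.
by move=> v; have [z <-] := piR_onto y v; have [w <-] := snd_fib_onto z; exists w.
Qed.

Fact wfil_comp_pullback r :
  pullback (piR y \o snd_fib) (flt H r) =
  pullback (piL x \o fst_fib)
    (flt F (gadj (galois_comp (wfil_galois x) (wfil_galois y)) r)).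
Proof.
have pullE (K1 K2 : wfiltration) (h : wfil_hom K1 K2) s (t : {set wfil_cover h}) :
    t != set0 -> (piR h @: t \in flt K2 s) =
                 (piL h @: t \in flt K1 (gadj (wfil_galois h) s)).
  move=> t0; have /setP/(_ t) := wfil_pullback h s.
  by rewrite !in_pullback ?flt_complex ?t0 //; [apply: piL_onto|apply: piR_onto].
apply/setP => t; rewrite !in_pullback ?flt_complex //; last first.
- exact: wfil_comp_piR_onto.
- exact: wfil_comp_piL_onto.
have [//|t0 /=] := eqVneq t set0.
rewrite (imset_comp (piR y) snd_fib) (imset_comp (piL x) fst_fib).
rewrite (pullE _ _ y) ?imset_eq0 // -(pullE _ _ x) ?imset_eq0 //.
rewrite -(imset_comp (piL y) snd_fib) -(imset_comp (piR x) fst_fib).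
have fibE : piL y \o snd_fib =1 piR x \o fst_fib 
  by move=> z; have /eqP := valP z.
by rewrite (eq_imset _ fibE).
Qed.

Fact wfil_comp_push :
  fprob_push (gfun (galois_comp (wfil_galois x) (wfil_galois y))) (wgt F) =1 wgt H.
Proof.
move=> r; rewrite fprob_push_comp -(wfil_push y).
exact: eq_fprob_push (wfil_push x) r.
Qed.

Definition wfil_comp : wfil_hom F H :=
  WFilHom wfil_comp_piL_onto wfil_comp_piR_onto
    wfil_comp_pullback wfil_comp_push.

End WFilComp.

End Filtrations.
Arguments flt {R} F q : rename.
Arguments piL {R F G} h z : rename.
Arguments piR {R F G} h z : rename.

(* Categories whose morphisms are considered up to the equivalence [mor_eq];   *)
(* [cat_comp x y] is [y] after [x].                                           *)
Record category := Category {
  cat_obj :> Type;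
  mor : cat_obj -> cat_obj -> Type;
  mor_eq : forall A B, mor A B -> mor A B -> Prop;
  cat_id : forall A, mor A A;
  cat_comp : forall A B D, mor A B -> mor B D -> mor A D;
  mor_eq_refl : forall A B (x : mor A B), mor_eq x x;
  mor_eq_sym : forall A B (x y : mor A B), mor_eq x y -> mor_eq y x;
  mor_eq_trans : forall A B (x y z : mor A B),
    mor_eq x y -> mor_eq y z -> mor_eq x z;
  cat_comp_eq : forall A B D (x x' : mor A B) (y y' : mor B D),
    mor_eq x x' -> mor_eq y y' -> mor_eq (cat_comp x y) (cat_comp x' y');
  cat_comp_idl : forall A B (x : mor A B), mor_eq (cat_comp (cat_id A) x) x;
  cat_comp_idr : forall A B (x : mor A B), mor_eq (cat_comp x (cat_id B)) x;
  cat_compA : forall A B D E (x : mor A B) (y : mor B D) (z : mor D E),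
    mor_eq (cat_comp x (cat_comp y z)) (cat_comp (cat_comp x y) z) }.

Record functor_on (C D : category) (Fo : C -> D) := FunctorOn {
  functor_mor : forall A B, mor A B -> mor (Fo A) (Fo B);
  functor_mor_eq : forall A B (x y : mor A B),
    mor_eq x y -> mor_eq (functor_mor x) (functor_mor y);
  functor_mor_id : forall A, mor_eq (functor_mor (cat_id A)) (cat_id (Fo A));
  functor_mor_comp : forall A B E (x : mor A B) (y : mor B E),
    mor_eq (functor_mor (cat_comp x y)) (cat_comp (functor_mor x) (functor_mor y)) }.

Section WFilCategory.
Variable R : realType.

Lemma galois_eq_refl d1 d2 (Q : finPOrderType d1) (S : finPOrderType d2)
  (f : galois Q S) : galois_eq f f.
Proof. by []. Qed.

Lemma galois_eq_sym d1 d2 (Q : finPOrderType d1) (S : finPOrderType d2)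
  (f h : galois Q S) : galois_eq f h -> galois_eq h f.
Proof. by case=> e1 e2; split=> ?; rewrite (e1, e2). Qed.

Lemma galois_eq_trans d1 d2 (Q : finPOrderType d1) (S : finPOrderType d2)
  (f h l : galois Q S) : galois_eq f h -> galois_eq h l -> galois_eq f l.
Proof. by case=> e1 e2 [e3 e4]; split=> ?; rewrite (e1, e2) (e3, e4). Qed.

Lemma galois_comp_eq d1 d2 d3 (Q : finPOrderType d1) (S : finPOrderType d2)
  (T : finPOrderType d3) (f f' : galois Q S) (h h' : galois S T) :
  galois_eq f f' -> galois_eq h h' ->
  galois_eq (galois_comp f h) (galois_comp f' h').
Proof. by case=> e1 e2 [e3 e4]; split=> ? /=; rewrite (e1, e4) (e3, e2). Qed.

Fact wfil_eq_refl (F G : wfiltration R) (x : wfil_hom F G) : wfil_eq x x.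
Proof. by split; [apply: galois_eq_refl | exists id; split=> //; exists id]. Qed.

Fact wfil_eq_sym (F G : wfiltration R) (x y : wfil_hom F G) :
  wfil_eq x y -> wfil_eq y x.
Proof.
case=> /galois_eq_sym exy [b [[c bK cK] bL bR]]; split=> //.
by exists c; split=> [|z|z]; [exists b | rewrite -bL cK | rewrite -bR cK].
Qed.

Fact wfil_eq_trans (F G : wfiltration R) (x y z : wfil_hom F G) :
  wfil_eq x y -> wfil_eq y z -> wfil_eq x z.
Proof.
case=> exy [b [bb bL bR]] [eyz [c [cb cL cR]]].
split; first exact: galois_eq_trans exy eyz.
exists (c \o b); split=> [|t|t]; first exact: bij_comp.
  by rewrite /= cL bL.
by rewrite /= cR bR.
Qed.

Fact wfil_comp_eq (F G H : wfiltration R) (x x' : wfil_hom F G)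
  (y y' : wfil_hom G H) :
  wfil_eq x x' -> wfil_eq y y' -> wfil_eq (wfil_comp x y) (wfil_comp x' y').
Proof.
case=> ex [b [[b' bK b'K] bL bR]] [ey [c [[c' cK c'K] cL cR]]].
split; first exact: galois_comp_eq.
have fP (z : fiber_prod x y) : piR x' (b (val z).1) == piL y' (c (val z).2).
  by rewrite bR cL (valP z).
have fP' (z : fiber_prod x' y') : piR x (b' (val z).1) == piL y (c' (val z).2).
  by rewrite -bR -cL b'K c'K (valP z).
pose h z : fiber_prod x' y' := exist _ (b (val z).1, c (val z).2) (fP z).
pose h' z : fiber_prod x y := exist _ (b' (val z).1, c' (val z).2) (fP' z).
exists h; split=> [|z|z] /=; [|exact: bL|exact: cR].
by exists h' => -[[z w] zw]; apply/val_inj; rewrite /= (bK, b'K) (cK, c'K).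
Qed.

Fact wfil_comp_idl (F G : wfiltration R) (x : wfil_hom F G) :
  wfil_eq (wfil_comp (wfil_id F) x) x.
Proof.
split; first by split.
exists (fun z : fiber_prod (wfil_id F) x => (val z).2); split=> //.
  have hP z : piR (wfil_id F) (piL x z) == piL x z by [].
  exists (fun z => exist _ (piL x z, z) (hP z)) => // -[[v z] vz].
  by apply/val_inj; rewrite /= -(eqP vz).
by move=> -[[v z] vz] /=; rewrite -(eqP vz).
Qed.

Fact wfil_comp_idr (F G : wfiltration R) (x : wfil_hom F G) :
  wfil_eq (wfil_comp x (wfil_id G)) x.
Proof.
split; first by split.
exists (fun z : fiber_prod x (wfil_id G) => (val z).1); split=> //.
  have hP z : piR x z == piL (wfil_id G) (piR x z) by [].
  exists (fun z => exist _ (z, piR x z) (hP z)) => // -[[z v] vz].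
  by apply/val_inj; rewrite /= (eqP vz).
by move=> -[[z v] vz] /=; rewrite (eqP vz).
Qed.

Fact wfil_compA (F G H K : wfiltration R) (x : wfil_hom F G)
  (y : wfil_hom G H) (z : wfil_hom H K) :
  wfil_eq (wfil_comp x (wfil_comp y z)) (wfil_comp (wfil_comp x y) z).
Proof.
split; first by split.
pose T1 := fiber_prod x (wfil_comp y z).
pose T2 := fiber_prod (wfil_comp x y) z.
have P1 (t : T1) : piR x (val t).1 == piL y (val (val t).2).1 by apply: valP t.
pose u1 (t : T1) : fiber_prod x y := exist _ ((val t).1, (val (val t).2).1) (P1 t).
have P2 (t : T1) : piR (wfil_comp x y) (u1 t) == piL z (val (val t).2).2.
  exact: valP (val t).2.
pose h (t : T1) : T2 := exist _ (u1 t, (val (val t).2).2) (P2 t).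
have P3 (t : T2) : piR y (val (val t).1).2 == piL z (val t).2 by apply: valP t.
pose u2 (t : T2) : fiber_prod y z := exist _ ((val (val t).1).2, (val t).2) (P3 t).
have P4 (t : T2) : piR x (val (val t).1).1 == piL (wfil_comp y z) (u2 t).
  exact: valP (val t).1.
pose h' (t : T2) : T1 := exist _ ((val (val t).1).1, u2 t) (P4 t).
exists h; split=> //; exists h'.
  move=> -[[a [[b c] bc]] abc]; apply/val_inj => /=; congr (_, _).
  exact/val_inj.
move=> -[[[[a b] ab] c] abc]; apply/val_inj => /=; congr (_, _).
exact/val_inj.
Qed.

Definition WFil : category :=
  @Category (wfiltration R) (@wfil_hom R) (@wfil_eq R) (@wfil_id R)
    (@wfil_comp R) wfil_eq_refl wfil_eq_sym wfil_eq_trans wfil_comp_eq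
    wfil_comp_idl wfil_comp_idr wfil_compA.

End WFilCategory.

Section Diagrams.
Variable R : realType.

Record wdiagram := WDiagram {
  didx : index_set R;
  dmult : ival didx -> nat;
  dwgt : fprob R (ival didx);
  dwgt_gt0 : forall I, ~~ ival_diag I -> (0 < dmult I)%N -> 0 < dwgt I }.
Arguments dmult : clear implicits.

Record wdgm_hom (A B : wdiagram) := WDgmHom {
  wdgm_galois : galois (didx A) (didx B);
  wdgm_mult : forall J, ~~ ival_diag J ->
    dmult B J = (\sum_(I | galois_bar wdgm_galois I == J) dmult A I)%N;
  wdgm_push : fprob_push (galois_bar wdgm_galois) (dwgt A) =1 dwgt B }.

Definition wdgm_eq (A B : wdiagram) (x y : wdgm_hom A B) : Prop :=
  galois_eq (wdgm_galois x) (wdgm_galois y).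

Lemma galois_bar_id (A : wdiagram) : galois_bar (galois_id (didx A)) =1 id.
Proof. by move=> -[[a b] le]; apply/val_inj. Qed.

Lemma galois_bar_comp (A B D : wdiagram) (x : wdgm_hom A B) (y : wdgm_hom B D) :
  galois_bar (galois_comp (wdgm_galois x) (wdgm_galois y)) =1
  galois_bar (wdgm_galois y) \o galois_bar (wdgm_galois x).
Proof. by move=> I; apply/val_inj. Qed.

Fact wdgm_id_mult (A : wdiagram) J : ~~ ival_diag J ->
  dmult A J = (\sum_(I | galois_bar (galois_id (didx A)) I == J) dmult A I)%N.
Proof.
by move=> _; under eq_bigl do rewrite galois_bar_id; rewrite big_pred1_eq.
Qed.

Fact wdgm_id_push (A : wdiagram) :
  fprob_push (galois_bar (galois_id (didx A))) (dwgt A) =1 dwgt A.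
Proof.
move=> J; rewrite -[RHS](fprob_push_id (dwgt A)); apply: eq_bigl => I.
by rewrite galois_bar_id.
Qed.

Definition wdgm_id (A : wdiagram) : wdgm_hom A A :=
  WDgmHom (@wdgm_id_mult A) (@wdgm_id_push A).

Section WDgmComp.
Variables (A B D : wdiagram) (x : wdgm_hom A B) (y : wdgm_hom B D).
Let xy := galois_comp (wdgm_galois x) (wdgm_galois y).

Fact wdgm_comp_mult J : ~~ ival_diag J ->
  dmult D J = (\sum_(I | galois_bar xy I == J) dmult A I)%N.
Proof.
move=> Jnd; rewrite (wdgm_mult y Jnd).
rewrite [RHS](partition_big (galois_bar (wdgm_galois x))
  (fun K => galois_bar (wdgm_galois y) K == J)) /=; last first.
  by move=> I; rewrite galois_bar_comp.
apply: eq_bigr => K /eqP KJ; rewrite (wdgm_mult x); last first.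
  by apply: contra Jnd => /eqP Kd; rewrite -KJ; apply/eqP; congr (gfun _ _).
apply: eq_bigl => I; rewrite galois_bar_comp /=.
by apply/esym/andb_idl => /eqP ->; rewrite KJ.
Qed.

Fact wdgm_comp_push : fprob_push (galois_bar xy) (dwgt A) =1 dwgt D.
Proof.
move=> J; rewrite -(wdgm_push y) -(eq_fprob_push _ (wdgm_push x)) -fprob_push_comp.
by apply: eq_bigl => I; rewrite galois_bar_comp.
Qed.

Definition wdgm_comp : wdgm_hom A D := WDgmHom wdgm_comp_mult wdgm_comp_push.

End WDgmComp.

Definition WDgm : category :=
  @Category wdiagram wdgm_hom wdgm_eq wdgm_id wdgm_comp
    (fun A B x => galois_eq_refl (wdgm_galois x))
    (fun A B x y => @galois_eq_sym _ _ _ _ (wdgm_galois x) (wdgm_galois y))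
    (fun A B x y z => @galois_eq_trans _ _ _ _
       (wdgm_galois x) (wdgm_galois y) (wdgm_galois z))
    (fun A B D x x' y y' => @galois_comp_eq _ _ _ _ _ _
       (wdgm_galois x) (wdgm_galois x') (wdgm_galois y) (wdgm_galois y'))
    (fun A B x => galois_eq_refl (wdgm_galois x))
    (fun A B x => galois_eq_refl (wdgm_galois x))
    (fun A B D E x y z => galois_eq_refl
       (galois_comp (galois_comp (wdgm_galois x) (wdgm_galois y))
          (wdgm_galois z))).

End Diagrams.
Arguments dmult {R} A I : rename.

Section PersistenceDiagram.
Context {R : realType}.
Variables (k : fieldType) (d : nat).

Definition ZB (F : filtration R) (I : ival (fidx F)) : nat :=
  \dim (cycles k d (flt F (ival_lo I)) :&: boundaries k d (flt F (ival_hi I))).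

Definition PD (F : filtration R) : ival (fidx F) -> int :=
  mobius_inv (fun I => (ZB I)%:Z).

Lemma PD_ge0 (F : filtration R) (I : ival (fidx F)) : 0 <= PD I.
Proof.
have predP (a : fidx F) :
    (exists p, forall q, (q < a) = (q <= p)) \/ (forall q, (q < a) = false).
  have [[p pa]|none] := pselect (exists p, p < a); last first.
    by right=> q; apply/negP => qa; apply: none; exists q.
  left; case: (@arg_maxP _ (fidx F) (fidx F) p (fun q => q < a) id pa) => m ma mmax.
  by exists m => q; apply/idP/idP => [qa|qm]; [apply: mmax | apply: le_lt_trans qm ma].
pose S (P : pred (ival (fidx F))) : int := \sum_(J | P J) PD J.
pose a := ival_lo I; pose b := ival_hi I; have leab : a <= b := ival_leP I.
have SE (P : pred (ival (fidx F))) q1 q2 (le : q1 <= q2) :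
    (forall J, P J = (ival_lo J <= q1) && (ival_hi J <= q2)) ->
    S P = (\dim (cycles k d (flt F q1) :&: boundaries k d (flt F q2)))%:Z.
  move=> PE; rewrite /S (eq_bigl _ _ PE); apply/esym.
  exact: (mobius_invE (fun K => (ZB K)%:Z) (@Ival _ (fidx F) (q1, q2) le)).
have S0 (P : pred (ival (fidx F))) : (forall J, P J = false) -> S P = 0.
  by move=> P0; rewrite /S big_pred0.
pose Pa (J : ival (fidx F)) := (ival_lo J < a) && (ival_hi J <= b).
pose Pb (J : ival (fidx F)) := (ival_lo J <= a) && (ival_hi J < b).
pose Pab (J : ival (fidx F)) := (ival_lo J < a) && (ival_hi J < b).
have PDE : PD I = S (fun J => (ival_lo J <= a) && (ival_hi J <= b))
                  - S Pa - S Pb + S Pab.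
  have -> : PD I = S (pred1 I) by rewrite /S big_pred1_eq.
  suff E : S (fun J => (ival_lo J <= a) && (ival_hi J <= b)) + S Pab
         = S (pred1 I) + S Pa + S Pb.
    by rewrite addrAC [_ - S Pa + _]addrAC E addrAC !addrK.
  rewrite /S !(big_mkcond _ (@PD F)) -!big_split; apply: eq_bigr => J _ /=.
  have -> : (J == I) = (ival_lo J == a) && (ival_hi J == b) by [].
  rewrite /Pa /Pb /Pab.
  by case: (ltgtP (ival_lo J) a) => _; case: (ltgtP (ival_hi J) b) => _ /=;
    rewrite ?addr0 ?add0r.
pose Z q := cycles k d (flt F q); pose B q := boundaries k d (flt F q).
have ZS q1 q2 : q1 <= q2 -> (Z q1 <= Z q2)%VS by move=> le; apply/cyclesS/flt_homo.
have BS q1 q2 : q1 <= q2 -> (B q1 <= B q2)%VS by move=> le; apply/boundariesS/flt_homo.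
have dimS U U' W W' : (U <= U')%VS -> (W <= W')%VS ->
    (\dim (U :&: W : {vspace chain k (vert F)}) <= \dim (U' :&: W'))%N.
  by move=> UU WW; apply: dimvS; apply: capvS.
rewrite PDE (SE _ a b leab) // -/(Z a) -/(B b).
have [eab|neab] := eqVneq a b.
  have -> : S Pb = S Pab.
    apply: eq_bigl => J; rewrite /Pb /Pab -eab.
    case: (ltP (ival_hi J) a) => [lt|_]; last by rewrite !andbF.
    have lta := le_lt_trans (ival_leP J) lt.
    by rewrite lta (ltW lta).
  rewrite subrK subr_ge0; case: (predP a) => [[p pP]|pP].
    have ltpa : p < a by rewrite pP.
    rewrite (SE Pa p b (le_trans (ltW ltpa) leab)) => [|J]; last by rewrite -pP.
    by rewrite lez_nat dimS // ZS // ltW.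
  by rewrite (S0 Pa) // => J; rewrite /Pa pP.
have ltab : a < b by rewrite lt_neqAle neab.
have [[q qP]|qP] := predP b; last by rewrite qP in ltab.
have leaq : a <= q by rewrite -qP.
have leqb : q <= b by rewrite ltW // qP.
rewrite (SE Pb a q leaq) => [|J]; last by rewrite -qP.
case: (predP a) => [[p pP]|pP]; last first.
  rewrite (S0 Pa) => [|J]; last by rewrite /Pa pP.
  rewrite (S0 Pab) => [|J]; last by rewrite /Pab pP.
  by rewrite subr0 addr0 subr_ge0 lez_nat dimS // BS.
have lepa : p <= a by rewrite ltW // pP.
rewrite (SE Pa p b (le_trans lepa leab)) => [|J]; last by rewrite -pP.
rewrite (SE Pab p q (le_trans lepa leaq)) => [|J]; last by rewrite -pP -qP.
rewrite -/(Z p) -/(B q).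
pose U := (Z p :&: B b)%VS; pose W := (Z a :&: B q)%VS.
have UW : (U :&: W)%VS = (Z p :&: B q)%VS.
  apply/eqP; rewrite eqEsubv; apply/andP; split.
    by apply: capvS; rewrite ?capvSl ?capvSr.
  by rewrite subv_cap; apply/andP; split; apply: capvS; rewrite ?ZS ?BS.
rewrite -UW -/U -/W -addrA [- _ + _]addrC addrACA -opprD subr_ge0 -!PoszD.
rewrite lez_nat -dimv_sum_cap leq_add2r.
by apply: dimvS; rewrite subv_add; apply/andP; split; apply: capvS; rewrite ?ZS ?BS.
Qed.

End PersistenceDiagram.

Section WeightedDiagramOf.
Context {R : realType}.
Variables (k : fieldType) (d : nat) (F : wfiltration R).

Definition wPD_wgt : fprob R (ival (fidx F)) :=
  fprob_push (@flip _ (fidx F)) (fprob_prod (wgt F) (wgt F)).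

Fact wPD_wgt_gt0 (I : ival (fidx F)) :
  ~~ ival_diag I -> (0 < `|PD k d I|)%N -> 0 < wPD_wgt I.
Proof.
move=> _ _; pose q := (ival_lo I, ival_hi I).
have qI : flip q == I.
  apply/eqP/val_inj; rewrite /= (min_idPl (ival_leP I)) (max_idPr (ival_leP I)).
  by rewrite /ival_lo /ival_hi /=; case: (ival_pair I).
rewrite /= /fprob_push_mass (bigD1 q) //=; apply: ltr_wpDr.
  by apply: sumr_ge0 => x _; apply: fprob_prod_ge0.
by rewrite /fprob_prod_mass mulr_gt0 // wgt_gt0.
Qed.

(* [PD] is nonnegative, so that the absolute value only changes its type. *)
Definition wPD : wdiagram R :=
  @WDiagram R (fidx F) (fun I => `|PD k d I|%N) wPD_wgt wPD_wgt_gt0.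

Lemma wPD_multE (I : ival (fidx F)) : (dmult wPD I)%:Z = PD k d I.
Proof. by rewrite /= gez0_abs ?PD_ge0. Qed.

End WeightedDiagramOf.

Section Costs.
Context {R : realType}.

Definition wfil_cost (p : \bar R) (F G : WFil R) (x : mor F G) : R :=
  let f := gfun (wfil_galois x) in
  lp_cost (wgt F)
    (fun q1 q2 =>
       `| `|val q1 - val q2| - `|val (f q1) - val (f q2)| |) p.

Definition dpl (Q S : {fset R}) (I1 I2 : ival Q) (J1 J2 : ival S) : R :=
  let a1 := val (ival_lo I1) in let b1 := val (ival_hi I1) in
  let a2 := val (ival_lo I2) in let b2 := val (ival_hi I2) in
  let c1 := val (ival_lo J1) in let d1 := val (ival_hi J1) in
  let c2 := val (ival_lo J2) in let d2 := val (ival_hi J2) in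
  Num.max (Num.max `|(a1 - a2) - (c1 - c2)| `|(a1 - b2) - (c1 - d2)|)
          (Num.max `|(b1 - a2) - (d1 - c2)| `|(b1 - b2) - (d1 - d2)|).

Definition wdgm_cost (p : \bar R) (A B : WDgm R) (x : mor A B) : R :=
  let f := galois_bar (wdgm_galois x) in
  lp_cost (dwgt A) (fun I1 I2 => dpl I1 I2 (f I1) (f I2)) p.

End Costs.

Section EditDistance.
Context {R : realType} {C : category}.
Variable cost : forall A B : C, mor A B -> R.

Definition arrow (A B : C) : Type := (mor A B + mor B A)%type.

Inductive zigzag (B : C) : C -> Type :=
| zz_last A of arrow A B : zigzag B A
| zz_step A D of arrow A D & zigzag B D : zigzag B A.

Definition arrow_cost A B (x : arrow A B) : R :=
  match x with inl y => cost y | inr y => cost y end.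

Fixpoint zigzag_cost B A (z : zigzag B A) : R :=
  match z with
  | zz_last _ x => arrow_cost x
  | zz_step _ _ x z' => arrow_cost x + zigzag_cost z'
  end.

Definition edit_dist (A B : C) : \bar R :=
  ereal_inf [set c | exists z : zigzag B A, c = (zigzag_cost z)%:E]%classic.

End EditDistance.

(* Main.v *)
Require Import Defs.
From HB Require Import structures.
From mathcomp Require Import all_classical all_reals all_analysis.
From mathcomp Require Import all_boot all_order all_algebra finmap ring lra zify.
Import Order.TTheory GRing.Theory Num.Theory.
Local Open Scope ring_scope.

Set Implicit Arguments.
Unset Strict Implicit.
Unset Printing Implicit Defensive.

(** Let [x : F -> G] be a morphism of weighted filtrations, with Galois
    connection [f -| g] and cover [Z].

    Functoriality.  Pulling a complex on [V] back along a surjection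
    [pi : Z -> V] enlarges its spaces of cycles and boundaries, so the numbers
    [ZB] of [F] and [G] at corresponding intervals differ in general.  For
    complexes [K1] contained in [K2] the invariant quantity is
    [dim (Z_d K1) - dim (Z_d K1 :&: B_d K2)], the rank of [H_d K1 -> H_d K2].
    Indeed, a section [s] of [pi] induces chain maps in both directions,
    [pi \o s] is the identity, and [s \o pi] moves every simplex of a pullback
    complex inside a larger simplex of the same complex, hence is chain
    homotopic to the identity there ([pullback_relative_dim]).  It follows that
    the difference between [ZB] of [G] at [J] and [ZB] of [F] at [g J] depends
    on the left endpoint of [J] only ([ZB_hom]).  A function of the left endpoint
    has its Moebius inverse supported on the diagonal ([mobius_inv_lo]), whereas
    Moebius inversion turns composition with the right adjoint [g] into summation
    over the fibres of the left adjoint [f] ([mobius_inv_adjoint], Rota's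
    theorem on Galois connections).  Off the diagonal this is the required formula
    for multiplicities ([PD_hom]).  The weights correspond because a monotone
    [f] commutes with [flip] ([wPD_push]).

    Chain level.  Let [wedge v] be the signed insertion of the vertex [v] into
    simplices, that is, left multiplication by [v] in the exterior algebra, and
    let [rbdry] be the augmented boundary.  All signs are absorbed in the rules
    [wedge_anticomm], [wedge_sqr] and
    [rbdry (wedge v c) + wedge v (rbdry c) = c].  Since the products of the
    operators [wedge v] applied to the empty simplex span all chains
    ([chain_ind]), the chain map [push f] of a vertex map is governed by
    [push f (wedge v c) = wedge (f v) (push f c)], and the homotopy between the
    chain maps of two vertex maps that differ at a single vertex [z] has a closed
    formula ([prism]).

    Costs.  Each of the four entries of the displacement of two flipped pairs is
    [`|(a - c) - (f a - f c)|] for a member [a] of the first pair and a member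
    [c] of the second one; by monotonicity this is the distortion
    [`| `|a - c| - `|f a - f c| |].  So the p-th power of the displacement is at
    most the sum of four p-th powers of distortions, each of which integrates to
    the p-th power of the cost in [WFil]; this gives the factor [4 `^ p^-1].  For
    [p = +oo] the displacement is at most the largest distortion.  An assignment
    on morphisms that multiplies costs by at most [m] does the same to the costs
    of zigzags, hence to edit distances ([edit_dist_functor]). *)

(** * Ranks of maps between quotients *)

Section RelativeRank.
Variables (k : fieldType) (E E' : vectType k).

(** The map from [U] to the quotient of [U'] by [U' :&: W'] induced by [phi] has
    its kernel inside [U :&: W], so the dimension of that quotient is at least
    [dim U - dim (U :&: W)]; the inequality says so without subtraction. *)
Lemma relative_dim_le (phi : 'Hom(E, E')) (U W : {vspace E}) (U' W' : {vspace E'}) :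
  (forall u, u \in U -> phi u \in U') ->
  (forall u, u \in U -> phi u \in W' -> u \in W) ->
  (\dim U + \dim (U' :&: W') <= \dim U' + \dim (U :&: W))%N.
Proof.
move=> UU' UW; set X := (phi @: U)%VS.
have kerU : (U :&: lker phi <= U :&: W)%VS.
  apply/subvP => u; rewrite !memv_cap memv_ker => /andP[uU /eqP u0].
  by rewrite uU UW // u0 mem0v.
have XU' : (X <= U')%VS by apply/subvP => _ /memv_imgP[u uU ->]; apply: UU'.
have XW : (X :&: W' <= phi @: (U :&: W))%VS.
  apply/subvP => y; rewrite memv_cap => /andP[/memv_imgP[u uU ->] uW].
  by rewrite memv_img // memv_cap uU UW.
(* As 0 lies in [W'], the kernel of [phi] on [U] lies in [W], so [phi] has the
   same kernel on [U] and on [U :&: W]. *)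
have dX := limg_ker_dim phi U; have dUW := limg_ker_dim phi (U :&: W).
have kerE : (U :&: W :&: lker phi = U :&: lker phi)%VS.
  apply: subv_anti; apply/andP; split; first by rewrite capvS // capvSl.
  by rewrite subv_cap kerU capvSr.
rewrite kerE in dUW.
have sumX : (\dim X + \dim (U' :&: W') <= \dim U' + \dim (X :&: W'))%N.
  rewrite -dimv_sum_cap capvA (capv_idPl XU') leq_add2r dimvS //.
  by rewrite subv_add XU' capvSl.
rewrite -dX -dUW -addnA -/X [leqRHS]addnCA leq_add2l.
by apply: leq_trans sumX _; rewrite leq_add2l dimvS.
Qed.

End RelativeRank.

(** * Exterior multiplication and the augmented boundary *)

Section Exterior.
Variables (k : fieldType) (V : finType).
Implicit Types (v w : V) (s t : {set V}) (c x y : chain k V).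

(** The sign of the permutation that moves [v], placed in front of [t], to its
    sorted place in [v |: t]. *)
Definition parity v t : k := (-1) ^+ #|[set u in t | (enum_rank u < enum_rank v)%N]|.

Lemma parity_sqr v t : parity v t * parity v t = 1.
Proof. by rewrite /parity -expr2 sqrr_sign. Qed.

Lemma parityU1 v w t : w \notin t ->
  parity v (w |: t) = parity v t * (-1) ^+ (enum_rank w < enum_rank v)%N.
Proof.
move=> wt; rewrite /parity -exprD; congr (_ ^+ _).
case: ltnP => [lt|ge].
  have -> : [set u in w |: t | (enum_rank u < enum_rank v)%N] =
          w |: [set u in t | (enum_rank u < enum_rank v)%N].
    apply/setP => u; rewrite !inE; case: eqVneq => [->|//]; by rewrite lt.
  by rewrite cardsU1 inE (negPf wt) addnC.
rewrite addn0; apply: eq_card => u; rewrite !inE.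
by case: eqVneq => [->|//]; rewrite ltnNge ge /= andbF.
Qed.

Lemma parityU1_self v t : parity v (v |: t) = parity v t.
Proof.
congr (_ ^+ _); apply: eq_card => u; rewrite !inE.
by case: eqVneq => [->|//]; rewrite ltnn !andbF.
Qed.

(** Exactly one of [v] and [w] precedes the other, so of the two signs
    [parity v (w |: t)] and [parity w (v |: t)] exactly one differs from the
    corresponding sign at [t]. *)
Lemma parityU1M v w t : v != w -> v \notin t -> w \notin t ->
  parity v (w |: t) * parity w (v |: t) = - (parity v t * parity w t).
Proof.
move=> vw vt wt; rewrite !parityU1 // mulrACA -[RHS]mulrN1; congr (_ * _).
have /negPf ne : (enum_rank v != enum_rank w :> nat).
  by apply: contra vw => /eqP/val_inj/enum_rank_inj ->.
by case: ltngtP ne => //= _ _; rewrite ?mulr1 ?mul1r.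
Qed.

Lemma parity_swap v w t : v != w -> v \notin t -> w \notin t ->
  parity v t * parity w (v |: t) = - (parity w t * parity v (w |: t)).
Proof.
move=> vw vt wt; have := parityU1M vw vt wt.
move: (parity_sqr v t) (parity_sqr v (w |: t)).
move: (parity v t) (parity v (w |: t)) (parity w t) (parity w (v |: t)) => a b c e.
move=> aa bb bE; rewrite -[LHS]mul1r -bb.
have -> : b * b * (a * e) = a * b * (b * e) by ring.
rewrite bE; have -> : a * b * - (a * c) = - (a * a * (c * b)) by ring.
by rewrite aa mul1r.
Qed.

Definition wedge v c : chain k V :=
  [ffun t : {set V} => if v \in t then parity v t * c (t :\ v) else 0].

(** The boundary of the augmented complex: vertices are sent to the empty
    simplex.  Keeping the empty simplex makes [rbdry_wedge] hold in all
    degrees. *)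
Definition rbdry c : chain k V :=
  [ffun t : {set V} => \sum_(v | v \notin t) parity v t * c (v |: t)].

Fact wedge_is_linear v : linear (wedge v).
Proof.
move=> a c e; apply/ffunP => t; rewrite !ffunE.
case: ifP => _; last by rewrite scaler0 addr0.
by rewrite mulrDr; congr (_ + _); apply: mulrCA.
Qed.
HB.instance Definition _ v :=
  GRing.isLinear.Build k (chain k V) (chain k V) _ (wedge v) (wedge_is_linear v).

Fact rbdry_is_linear : linear rbdry.
Proof.
move=> a c e; apply/ffunP => t; rewrite !ffunE scaler_sumr -big_split /=.
by apply: eq_bigr => v _; rewrite !ffunE mulrDr; congr (_ + _); apply: mulrCA.
Qed.
HB.instance Definition _ :=
  GRing.isLinear.Build k (chain k V) (chain k V) _ rbdry rbdry_is_linear.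

Lemma wedge_anticomm v w c : wedge v (wedge w c) = - wedge w (wedge v c).
Proof.
apply/ffunP => t; rewrite !ffunE !inE.
have [->|vw] := eqVneq v w; first by rewrite ?eqxx /= ?mulr0 ?if_same oppr0.
rewrite /=.
have uE : t :\ w :\ v = t :\ v :\ w by rewrite !setDDl setUC.
have [vt|vt] := boolP (v \in t); have [wt|wt] := boolP (w \in t);
  rewrite ?mulr0 ?oppr0 // uE.
set u := t :\ v :\ w.
have vu : v \notin u by rewrite !inE eqxx andbF.
have wu : w \notin u by rewrite !inE eqxx.
have tv : t :\ v = w |: u by rewrite setD1K // !inE eq_sym vw.
have tw : t :\ w = v |: u by rewrite /u -uE setD1K // !inE vw.
have pv : parity v t = parity v (w |: u) by rewrite -(setD1K vt) parityU1_self tv.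
have pw : parity w t = parity w (v |: u) by rewrite -(setD1K wt) parityU1_self tw.
rewrite pv pw tv tw !parityU1_self !mulrA -mulNr; congr (_ * _).
by rewrite mulrC parity_swap 1?eq_sym // mulrC.
Qed.

Lemma wedge_sqr v c : wedge v (wedge v c) = 0.
Proof.
by apply/ffunP => t; rewrite !ffunE; case: ifP => // _; rewrite !inE eqxx mulr0.
Qed.

(** The cone formula: every [wedge v] is a contraction of the augmented
    complex.  At a simplex containing [v], the faces opposite to the vertices
    other than [v] cancel in pairs by [parityU1M]. *)
Lemma rbdry_wedge v c : rbdry (wedge v c) = c - wedge v (rbdry c).
Proof.
apply/eqP; rewrite eq_sym subr_eq; apply/eqP/esym/ffunP => t.
rewrite !ffunE; have [vt|vt] := boolP (v \in t).
  rewrite [X in _ + _ * X](bigD1 v) ?inE ?eqxx //= mulrDr setD1K // mulrA.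
  have pE : parity v (t :\ v) = parity v t by rewrite -[in RHS](setD1K vt) parityU1_self.
  rewrite pE parity_sqr mul1r addrCA -[RHS]addr0; congr (_ + _).
  rewrite mulr_sumr [X in _ + X = _](eq_bigl (fun w => w \notin t)).
    rewrite -big_split big1 //= => w wt.
    have vw : v != w by apply: contraNneq wt => <-.
    rewrite ffunE !inE vt orbT !mulrA.
    have -> : (w |: t) :\ v = w |: (t :\ v).
      apply/setP => u; rewrite !inE; case: (eqVneq u w) => // ->.
      by rewrite eq_sym vw.
    rewrite -mulrDl.
    have wtv : w \notin t :\ v by rewrite !inE (negPf wt) andbF.
    have vtv : v \notin t :\ v by rewrite !inE eqxx.
    have pvw : parity v (w |: t :\ v) = parity v (w |: t).
      by rewrite -[in RHS](setD1K vt) setUCA parityU1_self.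
    have := parityU1M vw vtv wtv; rewrite setD1K // pE pvw => E.
    by rewrite [parity w t * _]mulrC E addNr mul0r.
  move=> w; rewrite !inE negb_and negbK.
  by case: eqVneq => [->|]; rewrite ?vt ?andbF ?andbT.
rewrite addr0 (bigD1 v) //= ffunE setU11 setU1K // parityU1_self mulrA parity_sqr.
rewrite mul1r big1 ?addr0 // => w /andP[wt wv].
by rewrite ffunE !inE (negPf vt) eq_sym (negPf wv) mulr0.
Qed.



Definition wedges (s : seq V) : chain k V := foldr wedge (simplex_chain k set0) s.

Lemma rbdry_simplex0 : rbdry (simplex_chain k set0) = 0.
Proof.
apply/ffunP => t; rewrite !ffunE big1 // => v vt; rewrite ffunE.
by rewrite setU_eq0 -cards_eq0 cards1 mulr0.
Qed.

Lemma chain_decomp c : c = \sum_t c t *: simplex_chain k t.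
Proof.
apply/ffunP => s; rewrite sum_ffunE (bigD1 s) //= big1 => [|t ts].
  by rewrite !ffunE eqxx addr0 /GRing.scale /= mulr1.
by rewrite !ffunE eq_sym (negPf ts) scaler0.
Qed.

Lemma wedge_simplex v t :
  wedge v (simplex_chain k t) =
  if v \in t then 0 else parity v t *: simplex_chain k (v |: t).
Proof.
have [vt|vt] := boolP (v \in t); apply/ffunP => s; rewrite !ffunE; case: ifPn => vs //.
- case: eqP => [E|_]; last by rewrite mulr0.
  by rewrite -E !inE eqxx in vt.
- have -> : (s == v |: t) = (s :\ v == t).
    by apply/eqP/eqP => [->|<-]; rewrite ?setU1K ?setD1K.
  case: eqP => [<-|_]; last by rewrite scaler0 mulr0.
  by rewrite -{1}(setD1K vs) parityU1_self.
- case: eqP => [E|_]; last by rewrite scaler0.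
  by rewrite E setU11 in vs.
Qed.

Lemma simplex_ind (P : chain k V -> Prop) :
  P 0 -> (forall a x y, P x -> P y -> P (a *: x + y)) ->
  (forall t, P (simplex_chain k t)) -> forall c, P c.
Proof.
move=> P0 PD Ps c; rewrite (chain_decomp c).
by elim/big_rec: _ => // t x _ Px; exact: PD.
Qed.

(** Up to sign, every simplex is obtained from the empty one by inserting its
    vertices one at a time. *)
Lemma chain_ind (P : chain k V -> Prop) :
  P 0 -> (forall a x y, P x -> P y -> P (a *: x + y)) ->
  P (simplex_chain k set0) -> (forall v x, P x -> P (wedge v x)) ->
  forall c, P c.
Proof.
move=> P0 PD P1 PW; apply: simplex_ind => // t.
have [n] := ubnP #|t|; elim: n t => // n IHn t; rewrite ltnS => tn.
have [->//|[v vt]] := set_0Vmem t.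
have /(PW v) : P (simplex_chain k (t :\ v)).
  by apply: IHn; apply: leq_trans tn; rewrite (cardsD1 v t) vt.
rewrite wedge_simplex !inE eqxx /= setD1K // => Pt.
have := PD (parity v (t :\ v)) _ _ Pt P0.
by rewrite addr0 scalerA parity_sqr scale1r.
Qed.

Lemma wedges_supp (s : seq V) t : wedges s t != 0 -> t = [set x in s] /\ #|t| = size s.
Proof.
elim: s t => [|v s IHs] t /=.
  rewrite ffunE; case: (t =P set0) => [-> _|_]; last by rewrite eqxx.
  by rewrite cards0; split=> //; apply/setP => x; rewrite !inE.
rewrite ffunE; case: ifPn => [vt|_]; last by rewrite eqxx.
rewrite mulf_eq0 negb_or => /andP[_ /IHs[tE ts]]; split.
  by rewrite set_cons -tE setD1K.
by rewrite (cardsD1 v) vt ts.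
Qed.

End Exterior.

(** * The chain map of a vertex map *)

Section Pushforward.
Variables (k : fieldType) (V W : finType).
Implicit Types (f g : V -> W) (c : chain k V).

(** The sequence [p] stands for the enumeration of [V]; as a parameter it can be
    split at a given vertex. *)
Definition push_simplex f (p : seq V) (t : {set V}) : chain k W :=
  wedges k (map f (filter (mem t) p)).

Definition push f c : chain k W :=
  \sum_t c t *: push_simplex f (enum V) t.

Fact push_is_linear f : linear (push f).
Proof.
move=> a c e; rewrite /push scaler_sumr -big_split; apply: eq_bigr => s _ /=.
by rewrite !ffunE scalerDl scalerA.
Qed.
HB.instance Definition _ f :=
  GRing.isLinear.Build k (chain k V) (chain k W) _ (push f) (push_is_linear f).

Lemma push_simplexE f t : push f (simplex_chain k t) = push_simplex f (enum V) t.
Proof.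
rewrite /push (bigD1 t) //= big1 => [|s st]; first by rewrite ffunE eqxx scale1r addr0.
by rewrite ffunE (negPf st) scale0r.
Qed.

Lemma wedges_swap w (s1 s2 : seq W) :
  wedges k (s1 ++ w :: s2) = (-1) ^+ size s1 *: wedge w (wedges k (s1 ++ s2)).
Proof.
elim: s1 => [|v s1 IHs] /=; first by rewrite scale1r.
by rewrite IHs linearZ /= wedge_anticomm exprS scalerN -scaleNr mulN1r.
Qed.

(** Sliding [f v] to the front passes it across the images of the vertices of
    [t] that are listed before [v], one sign for each. *)
Lemma push_simplexU1 f (p1 p2 : seq V) v (t : {set V}) :
    uniq (p1 ++ v :: p2) -> v \notin t ->
  push_simplex f (p1 ++ v :: p2) (v |: t) =
  (-1) ^+ size (filter (mem t) p1) *: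
    wedge (f v) (push_simplex f (p1 ++ v :: p2) t).
Proof.
rewrite cat_uniq /= negb_or => /and3P[_ /andP[vp1 _] /andP[vp2 _]] vt.
have fE (p : seq V) : v \notin p -> filter (mem (v |: t)) p = filter (mem t) p.
  move=> vp; apply: eq_in_filter => u up /=; rewrite !inE.
  by case: eqVneq => // uv; rewrite -uv up in vp.
rewrite /push_simplex !filter_cat /= setU11 (negPf vt) !fE // map_cat /=.
by rewrite wedges_swap size_map map_cat.
Qed.

Lemma parity_prefix (p1 p2 : seq V) v (t : {set V}) : enum V = p1 ++ v :: p2 ->
  parity k v t = (-1) ^+ size (filter (mem t) p1).
Proof.
move=> eV; have := enum_uniq V.
rewrite eV cat_uniq /= negb_or => /and3P[_ /andP[vp1 up2] /andP[vp2 _]].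
have rankE u : enum_rank u = index u (p1 ++ v :: p2) :> nat.
  by rewrite -eV -[in RHS](nth_enum_rank v u) index_uniq ?enum_uniq // -cardE.
have up1 : uniq p1 by have := enum_uniq V; rewrite eV cat_uniq => /andP[].
congr (_ ^+ _); rewrite -(card_uniqP (filter_uniq _ up1)); apply: eq_card => u.
rewrite !inE mem_filter /= !rankE !index_cat (negPf vp1) /= eqxx addn0.
case: ifP => [up|_]; first by rewrite index_mem up.
by rewrite ltnNge leq_addr.
Qed.

(** The sign from sorting [v] into a simplex of [V] and the one from sliding
    [f v] to the front in [W] are equal, whatever the orderings of [V] and [W]
    are; when [v] lies in the simplex already, [f v] would occur twice on the
    right. *)
Lemma push_wedge f v c : push f (wedge v c) = wedge (f v) (push f c).
Proof.
elim/simplex_ind: c => [||t]; first by rewrite !linear0.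
  by move=> a x y IHx IHy; rewrite !linearP /= IHx IHy.
have [p1 [p2 eV]] : exists p1 p2, enum V = p1 ++ v :: p2.
  by have := mem_enum V v; case/splitPr => p1 p2; exists p1, p2.
rewrite wedge_simplex push_simplexE; case: ifPn => vt.
  rewrite linear0 /push_simplex eV filter_cat /= vt map_cat wedges_swap.
  by rewrite linearZ /= wedge_sqr scaler0.
rewrite linearZ /= push_simplexE (parity_prefix t eV) eV push_simplexU1 -?eV ?enum_uniq //.
by rewrite scalerA -expr2 sqrr_sign scale1r.
Qed.

Lemma push_simplex0 f : push f (simplex_chain k set0) = simplex_chain k set0.
Proof.
rewrite push_simplexE /push_simplex (eq_filter (a2 := pred0)) ?filter_pred0 // => u.
by rewrite /= inE.
Qed.

(** Both sides obey the same recursion along [wedge], by [rbdry_wedge] and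
    [push_wedge]. *)
Lemma rbdry_push f c : rbdry (push f c) = push f (rbdry c).
Proof.
elim/chain_ind: c => [|a x y IHx IHy||v x IHx]; first by rewrite !linear0.
- by rewrite !linearP /= IHx IHy.
- by rewrite push_simplex0 !rbdry_simplex0 linear0.
- by rewrite push_wedge !rbdry_wedge IHx linearB /= push_wedge.
Qed.

Lemma push_supp f c t : push f c t != 0 ->
  exists s : {set V}, [/\ c s != 0, t = f @: s & #|t| = #|s|].
Proof.
move=> ct; have [s /andP[cs]] : exists s, (c s != 0) && (push_simplex f (enum V) s t != 0).
  apply/existsP; apply: contra_neqT ct; rewrite negb_exists => /forallP c0.
  rewrite /push sum_ffunE big1 // => s _; rewrite ffunE; apply/eqP.
  by have := c0 s; rewrite negb_and !negbK -mulf_eq0.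
case/wedges_supp => tE ts; exists s; split=> //.
  rewrite tE; apply/setP => w; rewrite inE.
  apply/mapP/imsetP => -[v vs ->]; exists v => //; move: vs;
    by rewrite mem_filter mem_enum ?andbT.
by rewrite ts size_map size_filter cardE enumT -size_filter.
Qed.

Lemma eq_push_simplex f g (t : {set V}) : {in t, f =1 g} ->
  push f (simplex_chain k t) = push g (simplex_chain k t).
Proof.
move=> fg; rewrite !push_simplexE /push_simplex; congr wedges.
by apply/eq_in_map => v; rewrite mem_filter => /andP[/fg].
Qed.

End Pushforward.

Lemma push_id (k : fieldType) (V : finType) (f : V -> V) (c : chain k V) :
  f =1 id -> push f c = c.
Proof.
move=> fE; elim/chain_ind: c => [|a x y IHx IHy||v x IHx]; first by rewrite linear0.
- by rewrite linearP /= IHx IHy.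
- by rewrite push_simplex0.
- by rewrite push_wedge IHx fE.
Qed.

Lemma push_comp (k : fieldType) (V W U : finType) (f : W -> U) (g : V -> W)
    (c : chain k V) : push (f \o g) c = push f (push g c).
Proof.
elim/chain_ind: c => [|a x y IHx IHy||v x IHx]; first by rewrite !linear0.
- by rewrite !linearP /= IHx IHy.
- by rewrite !push_simplex0.
- by rewrite !push_wedge IHx.
Qed.

(** * Homotopy between vertex maps that differ at one vertex *)

Section Homotopy.
Variables (k : fieldType) (V W : finType) (f g : V -> W) (z : V).
Hypothesis fg : forall v, v != z -> f v = g v.
Implicit Types c : chain k V.

Definition star c : chain k V := [ffun t : {set V} => if z \in t then c t else 0].

Fact star_is_linear : linear star.
Proof.
move=> a c e; apply/ffunP => t; rewrite !ffunE.
by case: ifP => // _; rewrite scaler0 addr0.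
Qed.
HB.instance Definition _ :=
  GRing.isLinear.Build k (chain k V) (chain k V) _ star star_is_linear.

(** Restricted to the simplices through [z], the operator joins the image under
    [f] to the additional vertex [g z]; the join contains both [f z] and [g z],
    and its two facets opposite to them are the images under [g] and [f]. *)
Definition prism c : chain k W := wedge (g z) (push f (star c)).

Fact prism_is_linear : linear prism.
Proof. by move=> a c e; rewrite /prism !linearP. Qed.
HB.instance Definition _ :=
  GRing.isLinear.Build k (chain k V) (chain k W) _ prism prism_is_linear.

Lemma star_off c : (forall t : {set V}, z \in t -> c t = 0) -> star c = 0.
Proof. by move=> c0; apply/ffunP => t; rewrite !ffunE; case: ifP => // /c0. Qed.

Lemma star_wedge c : star (wedge z c) = wedge z c.
Proof. by apply/ffunP => t; rewrite !ffunE; case: (z \in t). Qed.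

Lemma star_rbdry_off c :
  (forall t : {set V}, z \in t -> c t = 0) -> star (rbdry c) = 0.
Proof.
move=> c0; apply: star_off => t zt; rewrite ffunE big1 // => v _.
by rewrite c0 ?mulr0 // in_setU zt orbT.
Qed.

(** On simplices that avoid [z] both sides vanish.  A simplex through [z] is, up
    to sign, of the form [wedge z y] where [y] avoids [z], and there the cone
    formula applied to [g z] and then to [f z] computes the left-hand side. *)
Lemma rbdry_prism c : rbdry (prism c) + prism (rbdry c) = push f c - push g c.
Proof.
elim/simplex_ind: c => [|a x y IHx IHy|t]; first by rewrite !linear0 ?subrr !addr0.
  by rewrite !linearP /= addrACA -scalerDr IHx IHy [RHS]addrACA -scalerDr.
have off (s : {set V}) : z \notin s ->
    forall u : {set V}, z \in u -> simplex_chain k s u = 0.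
  by move=> zs u zu; rewrite ffunE; case: eqP => // us; rewrite -us zu in zs.
have eqs (s : {set V}) : z \notin s ->
    push f (simplex_chain k s) = push g (simplex_chain k s).
  by move=> zs; apply: eq_push_simplex => v vs; apply: fg; apply: contraNneq zs => <-.
have [zt|zt] := boolP (z \in t); last first.
  rewrite /prism (star_off (off _ zt)) (star_rbdry_off (off _ zt)).
  by rewrite !linear0 eqs // subrr addr0.
set y := simplex_chain k (t :\ z).
have zy : z \notin t :\ z by rewrite !inE eqxx.
have -> : simplex_chain k t = parity k z (t :\ z) *: wedge z y.
  by rewrite wedge_simplex (negPf zy) setD1K // scalerA parity_sqr scale1r.
rewrite !linearZ /= -scalerDr -scalerDr; congr (_ *: _).
have -> : prism (rbdry (wedge z y)) = - wedge (g z) (wedge (f z) (push f (rbdry y))).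
  rewrite rbdry_wedge /prism linearB /= star_wedge star_off; last exact: off.
  by rewrite sub0r !linearN /= push_wedge.
have -> : prism (wedge z y) = wedge (g z) (wedge (f z) (push f y)).
  by rewrite /prism star_wedge push_wedge.
rewrite !rbdry_wedge rbdry_push !push_wedge linearB /= -eqs // opprB.
by rewrite addrA addrAC addrK.
Qed.

End Homotopy.

(** * Cycles and boundaries of subcomplexes *)

Section Complexes.
Variables (k : fieldType) (V : finType).
Implicit Types (L M : {set {set V}}) (c : chain k V).

Lemma bdryE c t : bdry c t = if t == set0 then 0 else rbdry c t.
Proof.
elim/simplex_ind: c => [|a x y IHx IHy|s].
- by rewrite !linear0 ffunE if_same.
- rewrite !linearP !ffunE IHx IHy.
  by case: ifP => _; rewrite ?scaler0 ?addr0 ?ffunE.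
have -> : bdry (simplex_chain k s) = simplex_bdry k s.
  rewrite /bdry (bigD1 s) //= big1 => [|u us]; first by rewrite ffunE eqxx scale1r addr0.
  by rewrite ffunE (negPf us) scale0r.
rewrite /simplex_bdry ffunE; case: leqP => s1.
  rewrite ffunE; case: eqP => // /eqP t0; rewrite big1 // => v vt.
  rewrite ffunE; case: eqP => [E|]; last by rewrite mulr0.
  by move: s1; rewrite -E cardsU1 vt ltnS leqn0 cards_eq0 (negPf t0).
rewrite sum_ffunE; case: eqP => [->|_].
  rewrite big1 // => v vs; rewrite !ffunE; case: eqP => [E|]; last by rewrite scaler0.
  by move: s1; rewrite (cardsD1 v) vs -E cards0.
rewrite big_mkcond [RHS]big_mkcond; apply: eq_bigr => v _; rewrite !ffunE.
case: (boolP (v \in s)) => vs; case: (boolP (v \in t)) => vt //=.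
- case: eqP => [E|_]; last by rewrite scaler0.
  by rewrite E !inE eqxx in vt.
- have -> : (v |: t == s) = (t == s :\ v).
    by apply/eqP/eqP => [<-|->]; rewrite ?setU1K ?setD1K.
  case: eqP => [->|_]; last by rewrite scaler0 mulr0.
  by rewrite -[in RHS]parityU1_self setD1K.
- by case: eqP => [E|_]; rewrite ?mulr0 // -E setU11 in vs *.
Qed.

Lemma chainsP d L c :
  reflect (forall t : {set V}, c t != 0 -> t \in L /\ #|t| = d.+1)
    (c \in chains k d L).
Proof.
apply: (iffP idP) => [cL t|cL].
  move: cL; rewrite /chains => /memv_sumP[b bL ->].
  apply: contraNP => /not_andP tL.
  rewrite sum_ffunE big1 // => s sL; have /vlineP[a ->] := bL s sL.
  rewrite !ffunE; case: eqP => [E|]; last by rewrite scaler0.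
  by case/andP: sL => sL /eqP sd; case: tL; rewrite E.
rewrite (chain_decomp c); apply: memv_suml => t _.
have [->|/cL[tL td]] := eqVneq (c t) 0; first by rewrite scale0r mem0v.
by apply: memvZ; apply: (subvP (sumv_sup t _ _)) (memv_line _); rewrite ?tL ?td ?eqxx.
Qed.

Lemma bdry_chainsS d L c : c \in chains k d.+1 L -> bdry c = rbdry c.
Proof.
move=> /chainsP cL; apply/ffunP => t; rewrite bdryE; case: eqP => // ->.
rewrite ffunE big1 // => v _; suff -> : c (v |: set0) = 0 by rewrite mulr0.
apply/eqP; apply: contraT => /cL[_]; by rewrite setU0 cards1.
Qed.

Lemma cyclesP d L c : reflect (c \in chains k d L /\ bdry c = 0) (c \in cycles k d L).
Proof.
rewrite /cycles memv_cap memv_ker lfunE /=.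
by apply: (iffP andP) => -[cL /eqP].
Qed.

Lemma boundariesP d L c :
  reflect (exists2 b, b \in chains k d.+1 L & c = rbdry b) (c \in boundaries k d L).
Proof.
apply: (iffP memv_imgP) => -[b bL ->]; exists b => //;
  by rewrite ?lfunE /= (bdry_chainsS bL).
Qed.

(** In degree zero every chain is a cycle of the unreduced complex, but its
    augmentation may be nonzero. *)
Lemma rbdry_cycle c : bdry c = 0 -> rbdry c = rbdry c set0 *: simplex_chain k set0.
Proof.
move=> c0; apply/ffunP => t; rewrite [RHS]ffunE [simplex_chain _ _ _]ffunE.
have := bdryE c t; rewrite c0 ffunE; case: eqP => [-> _|_ <-].
  by rewrite /GRing.scale /= mulr1.
by rewrite scaler0.
Qed.

End Complexes.

Section ChainMaps.
Variables (k : fieldType) (V W : finType) (f : V -> W).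
Variables (L : {set {set V}}) (M : {set {set W}}).
Hypothesis fLM : forall t : {set V}, t \in L -> f @: t \in M.
Implicit Types c : chain k V.

Lemma push_chains d c : c \in chains k d L -> push f c \in chains k d M.
Proof.
move=> /chainsP cL; apply/chainsP => t /push_supp[s [/cL[sL sd] -> ->]].
by split=> //; apply: fLM.
Qed.

Lemma push_cycles d c : c \in cycles k d L -> push f c \in cycles k d M.
Proof.
move=> /cyclesP[cL c0]; apply/cyclesP; split; first exact: push_chains.
apply/ffunP => t; rewrite bdryE rbdry_push (rbdry_cycle c0) linearZ /=.
by rewrite push_simplex0 !ffunE; case: eqP => //; rewrite scaler0.
Qed.

Lemma push_boundaries d c : c \in boundaries k d L -> push f c \in boundaries k d M.
Proof.
move=> /boundariesP[b bL ->]; apply/boundariesP; exists (push f b).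
  exact: push_chains.
by rewrite rbdry_push.
Qed.

(** The prism operator kills the empty simplex, so the augmentation of a cycle
    of degree zero does not contribute. *)
Lemma push_contiguous (g : V -> W) (z : V) d c :
    (forall v, v != z -> f v = g v) ->
    (forall t : {set V}, t \in L -> z \in t -> g z |: f @: t \in M) ->
  c \in cycles k d L -> push f c - push g c \in boundaries k d M.
Proof.
move=> fg fgLM /cyclesP[/chainsP cL c0]; apply/boundariesP.
have prism0 : prism f g z (simplex_chain k set0) = 0.
  rewrite /prism star_off ?linear0 // => t zt; rewrite ffunE.
  by case: eqP => // t0; rewrite t0 inE in zt.
exists (prism f g z c); last first.
  by rewrite -(rbdry_prism fg) (rbdry_cycle c0) linearZ /= prism0 scaler0 addr0.
apply/chainsP => t; rewrite ffunE; case: ifP => [gt|]; last by rewrite eqxx.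
rewrite mulf_eq0 negb_or => /andP[_ /push_supp[s []]].
rewrite ffunE; case: ifP => [zs /cL[sL sd] tE ts|]; last by rewrite eqxx.
by rewrite -(setD1K gt) tE fgLM // -tE setD1K // (cardsD1 (g z)) gt ts sd.
Qed.

End ChainMaps.

(** * Invariance of the rank under pullback *)

Section Pullback.
Variables (k : fieldType) (V Z : finType) (pi : Z -> V).
Hypothesis piS : Defs.onto pi.
Variable d : nat.

(** The map [a] is reached from the identity by changing the image of one vertex
    at a time.  All intermediate maps lie over [V], and adding to a simplex a
    vertex with the same image in [V] as one of its own does not leave the
    pullback complex. *)
Lemma push_retract (a : Z -> Z) (K : {set {set V}}) (c : chain k Z) :
    is_complex K -> (forall z, pi (a z) = pi z) ->
  c \in cycles k d (pullback pi K) ->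
  c - push a c \in boundaries k d (pullback pi K).
Proof.
move=> Kc pia cK.
(* [f p] has replaced the vertices in [p] and no others. *)
pose f (p : seq Z) z := if z \in p then a z else z.
have pif p z : pi (f p z) = pi z by rewrite /f; case: ifP.
have piim p (t : {set Z}) : pi @: (f p @: t) = pi @: t.
  by rewrite -imset_comp; apply: eq_imset => z; apply: pif.
have fpull p (t : {set Z}) : t \in pullback pi K -> f p @: t \in pullback pi K.
  by rewrite !in_pullback // imset_eq0 piim.
have step p : c - push (f p) c \in boundaries k d (pullback pi K).
  elim: p => [|z p IHp]; first by rewrite push_id ?subrr ?mem0v.
  rewrite -(subrKA (push (f p) c)) memvD //.
  apply: (@push_contiguous _ _ _ (f p) _ _ (f (z :: p)) z _ _ _ _ cK) => [v vz|t].
    by rewrite /f inE (negPf vz).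
  rewrite !in_pullback // => /andP[t0 tK] zt; rewrite setU_eq0 -cards_eq0 cards1 /=.
  rewrite imsetU1 pif piim (setUidPr _) // sub1set.
  by apply: imset_f.
suff fE : f (enum Z) = a by rewrite -fE.
by apply/funext => z; rewrite /f mem_enum.
Qed.

(** The rank of [H_d K1 -> H_d K2] equals that of the pullbacks, written without
    subtraction.  A section of [pi] gives one inequality and [pi] itself the
    other. *)
Lemma pullback_relative_dim (K1 K2 : {set {set V}}) :
    is_complex K1 -> is_complex K2 -> K1 \subset K2 ->
  (\dim (cycles k d K1) +
     \dim (cycles k d (pullback pi K1) :&: boundaries k d (pullback pi K2)) =
   \dim (cycles k d (pullback pi K1)) +
     \dim (cycles k d K1 :&: boundaries k d K2))%N.
Proof.
move=> K1c K2c K12; have [s sK] := choice piS.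
have sub : pullback pi K1 \subset pullback pi K2.
  by apply/subsetP => t; rewrite !in_pullback // => /andP[->] /(subsetP K12).
have spull (K : {set {set V}}) (t : {set V}) : is_complex K -> t \in K ->
    s @: t \in pullback pi K.
  move=> Kc tK; rewrite in_pullback // imset_eq0 -imset_comp.
  rewrite (eq_imset (g := id)) ?imset_id ?tK ?andbT => [|v]; last exact: sK.
  by apply: contraTneq tK => ->; case/is_complexP: Kc.
have pipull (K : {set {set V}}) (t : {set Z}) : is_complex K ->
    t \in pullback pi K -> pi @: t \in K.
  by move=> Kc; rewrite in_pullback // => /andP[].
apply/eqP; rewrite eqn_leq; apply/andP; split.
  apply: (relative_dim_le (phi := linfun (push s))) => u; rewrite lfunE /=.
    by apply: push_cycles => t; apply: spull.
  move=> _ /(push_boundaries (pipull K2 ^~ K2c)).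
  by rewrite -push_comp push_id.
apply: (relative_dim_le (phi := linfun (push pi))) => u; rewrite lfunE /=.
  by apply: push_cycles => t; apply: pipull.
move=> uZ /(push_boundaries (spull K2 ^~ K2c)); rewrite -push_comp => sB.
rewrite -[u](subrK (push (s \o pi) u)) memvD // (subvP (boundariesS _ _ sub)) //.
by apply: push_retract => // z; apply: sK.
Qed.

End Pullback.

(** * Moebius inversion and adjunctions *)

Section MobiusInversion.
Context {d1 d2 : Order.disp_t} {T : finPOrderType d1} {U : finPOrderType d2}.

Lemma mobius_invD (h1 h2 : T -> int) x :
  mobius_inv (fun t => h1 t + h2 t) x = mobius_inv h1 x + mobius_inv h2 x.
Proof.
apply/esym; apply: (mobius_inv_unique (g := fun t => mobius_inv h1 t + mobius_inv h2 t)) => t.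
by rewrite big_split -!mobius_invE.
Qed.

Lemma eq_mobius_inv (h1 h2 : T -> int) : h1 =1 h2 -> mobius_inv h1 =1 mobius_inv h2.
Proof. by move=> eh; apply: mobius_inv_unique => t; rewrite -eh mobius_invE. Qed.

(** Rota: the values below [g u] sum up over all [t] with [f t] below [u]; group
    them by the value of [f]. *)
Lemma mobius_inv_adjoint (f : T -> U) (g : U -> T) (h : T -> int) u :
    (forall t w, (f t <= w)%O = (t <= g w)%O) ->
  mobius_inv (h \o g) u = \sum_(t | f t == u) mobius_inv h t.
Proof.
move=> fgP; apply/esym.
apply: (mobius_inv_unique (g := fun u => \sum_(t | f t == u) mobius_inv h t)) => {u} u /=.
rewrite mobius_invE (partition_big f (fun w => (w <= u)%O)) /=; last first.
  by move=> t; rewrite fgP.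
apply: eq_bigr => w wu; apply: eq_bigl => t.
by apply: andb_idl => /eqP ft; rewrite -fgP ft.
Qed.

End MobiusInversion.

(** The diagonal intervals below [J] are those at the points [q] with
    [q <= ival_lo J], so a mass placed on the diagonal accumulates to a function
    of the left endpoint. *)
Lemma mobius_inv_lo (disp : Order.disp_t) (Q : finPOrderType disp)
    (h : Q -> int) (J : ival Q) :
  mobius_inv (fun I : ival Q => h (ival_lo I)) J =
  if ival_diag J then mobius_inv h (ival_lo J) else 0.
Proof.
apply/esym; apply: (mobius_inv_unique
  (g := fun I => if ival_diag I then mobius_inv h (ival_lo I) else 0)) => {J} J.
rewrite mobius_invE -big_mkcondr /=.
pose pt (q : Q) : ival Q := @Ival _ Q (q, q) (lexx q).
rewrite [RHS](reindex_onto pt (@ival_lo _ Q)) /=; last first.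
  move=> I /andP[_ /eqP E]; apply/val_inj => /=; rewrite [in X in (_, X)]E.
  by rewrite /ival_lo /ival_hi /=; case: (ival_pair I).
apply: eq_bigl => q; rewrite ival_leE /ival_diag /= !eqxx !andbT.
rewrite /ival_lo /ival_hi /=.
by apply/esym/andb_idr => /le_trans; apply; apply: ival_leP.
Qed.

Definition adj_bar d1 d2 (Q : finPOrderType d1) (S : finPOrderType d2)
    (f : galois Q S) (J : ival S) : ival Q :=
  @Ival _ Q (gadj f (ival_lo J), gadj f (ival_hi J)) (gadj_homo f (ival_leP J)).

Lemma galois_barP d1 d2 (Q : finPOrderType d1) (S : finPOrderType d2)
    (f : galois Q S) (I : ival Q) (J : ival S) :
  (galois_bar f I <= J)%O = (I <= adj_bar f J)%O.
Proof. by rewrite !ival_leE /= !galoisP. Qed.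

(** * The functor on morphisms *)

Section Functor.
Context {R : realType}.
Variables (k : fieldType) (d : nat).

Section Morphism.
Variables (F G : wfiltration R) (x : wfil_hom F G).
Let f := wfil_galois x.

Let zdim (H : filtration R) (q : fidx H) : int := (\dim (cycles k d (flt H q)))%:Z.

(** The ranks of [H_d] over [J] and over [adj_bar f J] are both equal to the rank
    over the common cover, so [ZB] and the dimension of the space of cycles have
    the same defect. *)
Lemma ZB_hom (J : ival (fidx G)) :
  (ZB k d J)%:Z = (ZB k d (adj_bar f J))%:Z +
    (zdim (ival_lo J) - zdim (gadj f (ival_lo J))).
Proof.
have sub := flt_homo (ival_leP J).
have := pullback_relative_dim k (piR_onto x) d (flt_complex _) (flt_complex _) sub.
have := pullback_relative_dim k (piL_onto x) d (flt_complex _) (flt_complex _)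
  (flt_homo (ival_leP (adj_bar f J))).
rewrite /zdim /ZB !wfil_pullback -[ival_lo (adj_bar f J)]/(gadj f (ival_lo J)).
rewrite -[ival_hi (adj_bar f J)]/(gadj f (ival_hi J)) -/f => EL ER.
by lia.
Qed.

Lemma PD_hom (J : ival (fidx G)) : ~~ ival_diag J ->
  PD k d J = \sum_(I | galois_bar f I == J) PD k d I.
Proof.
move=> /negPf Jd; rewrite /PD (eq_mobius_inv ZB_hom).
rewrite (mobius_invD (fun J => (ZB k d (adj_bar f J))%:Z)
  (fun J => zdim (ival_lo J) - zdim (gadj f (ival_lo J)))).
rewrite (mobius_inv_lo (fun q => zdim q - zdim (gadj f q))) Jd addr0.
exact: (mobius_inv_adjoint (fun I => (ZB k d I)%:Z) J (@galois_barP _ _ _ _ f)).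
Qed.

Lemma wPD_mult_hom (J : ival (fidx G)) : ~~ ival_diag J ->
  dmult (wPD k d G) J = (\sum_(I | galois_bar f I == J) dmult (wPD k d F) I)%N.
Proof.
move=> Jd; apply/eqP; rewrite -eqz_nat wPD_multE PD_hom // (big_morph Posz PoszD (erefl _)).
by apply/eqP/eq_bigr => I _; rewrite wPD_multE.
Qed.

End Morphism.

Lemma galois_bar_flip d1 d2 (Q : finOrderType d1) (S : finOrderType d2)
    (f : galois Q S) (q : Q * Q) :
  galois_bar f (flip q) = flip (gfun f q.1, gfun f q.2).
Proof.
apply/val_inj => /=; rewrite /ival_lo /ival_hi /=.
by case: (leP q.1 q.2) => [/(gfun_homo f)|/ltW/(gfun_homo f)] le;
  [rewrite (min_idPl le) (max_idPr le) | rewrite (min_idPr le) (max_idPl le)].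
Qed.

(** By [galois_bar_flip] both sides are images of the product measure under the
    same map, since [gfun f] carries the weight of [F] to that of [G]. *)
Lemma wPD_push (F G : wfiltration R) (x : wfil_hom F G) :
  fprob_push (galois_bar (wfil_galois x)) (wPD_wgt F) =1 wPD_wgt G.
Proof.
move=> J; rewrite /wPD_wgt -fprob_push_comp /= /fprob_push_mass.
pose ff (q : fidx F * fidx F) := (gfun (wfil_galois x) q.1, gfun (wfil_galois x) q.2).
rewrite (partition_big ff (fun r => flip r == J)) /=; last first.
  by move=> q; rewrite galois_bar_flip.
apply: eq_bigr => -[r1 r2] /eqP rJ; rewrite /fprob_prod_mass /= -!(wfil_push x) /=.
rewrite /fprob_push_mass mulr_suml; under [RHS]eq_bigr do rewrite mulr_sumr.
rewrite pair_big /=; apply: eq_bigl => q; rewrite galois_bar_flip -/(ff q).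
rewrite -[(_ == r1) && _]/(ff q == (r1, r2)).
by apply: andb_idl => /eqP ->; rewrite rJ.
Qed.

Definition wPD_mor (F G : WFil R) (x : mor F G) : @mor (WDgm R) (wPD k d F) (wPD k d G) :=
  @WDgmHom R (wPD k d F) (wPD k d G) (wfil_galois x) (@wPD_mult_hom F G x) (wPD_push x).

Definition wPD_functor : @functor_on (WFil R) (WDgm R) (wPD k d).
Proof.
by exists wPD_mor => // F G x y [].
Defined.

End Functor.

(** * Edit distances and functors *)

Section EditDistanceFunctor.
Context {R : realType} {C D : category} (Fo : C -> D).
Variable Fm : forall A B : C, mor A B -> mor (Fo A) (Fo B).
Variables (costC : forall A B : C, mor A B -> R) (costD : forall A B : D, mor A B -> R).
Variable m : R.
Hypothesis m_gt0 : 0 < m.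
Hypothesis costF : forall A B (x : mor A B), costD (Fm x) <= m * costC x.

Lemma zigzag_map (B A : C) (z : zigzag B A) :
  exists z' : zigzag (Fo B) (Fo A), zigzag_cost costD z' <= m * zigzag_cost costC z.
Proof.
have arrF (A1 B1 : C) (y : arrow A1 B1) :
    exists y' : arrow (Fo A1) (Fo B1), arrow_cost costD y' <= m * arrow_cost costC y.
  by case: y => y; [exists (inl (Fm y)) | exists (inr (Fm y))]; apply: costF.
elim: z => [A1 y|A1 D1 y z [z' zz']]; have [y' yy'] := arrF _ _ y.
  by exists (zz_last y').
by exists (zz_step y' z'); rewrite /= mulrDr lerD.
Qed.

Lemma edit_dist_functor (A B : C) :
  (edit_dist costD (Fo A) (Fo B) <= m%:E * edit_dist costC A B)%E.
Proof.
rewrite -lee_pdivrMl //; apply: le_ereal_inf_tmp => _ [z ->].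
rewrite lee_pdivrMl //; have [z' zz'] := zigzag_map z.
by apply: ge_ereal_inf; exists (zigzag_cost costD z')%:E; [exists z' | rewrite lee_fin].
Qed.

End EditDistanceFunctor.

(** * Sums against image measures *)

Section Laws.
Context {R : realType}.

(** Stated on expectations, so that image measures and the two coordinates of a
    product measure are treated alike. *)
Definition has_law (T U : finType) (f : T -> U) (mu : fprob R T) (nu : fprob R U) : Prop :=
  forall phi : U -> R, \sum_x phi (f x) * mu x = \sum_u phi u * nu u.

Lemma has_law_push (T U : finType) (f : T -> U) (mu : fprob R T) :
  has_law f mu (fprob_push f mu).
Proof.
move=> phi; rewrite (partition_big f xpredT) //=; apply: eq_bigr => u _.
by rewrite mulr_sumr; apply: eq_bigr => x /eqP ->.
Qed.

Lemma has_law_fst (T U : finType) (mu : fprob R T) (nu : fprob R U) :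
  has_law fst (fprob_prod mu nu) mu.
Proof.
move=> phi; rewrite -(pair_bigA _ (fun x y => phi x * (mu x * nu y))) /=.
apply: eq_bigr => x _; under eq_bigr do rewrite mulrA.
by rewrite -mulr_sumr fprob_sum mulr1.
Qed.

Lemma has_law_snd (T U : finType) (mu : fprob R T) (nu : fprob R U) :
  has_law snd (fprob_prod mu nu) nu.
Proof.
move=> phi; rewrite -(pair_bigA _ (fun x y => phi y * (mu x * nu y))) exchange_big /=.
apply: eq_bigr => y _; under eq_bigr do rewrite mulrCA.
by rewrite -mulr_suml fprob_sum mul1r.
Qed.

(** Variables [f] and [g] on two independent copies of the same space. *)
Lemma has_law2 (T U : finType) (f g : T -> U) (mu : fprob R T) (nu : fprob R U)
    (phi : U -> U -> R) : has_law f mu nu -> has_law g mu nu ->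
  \sum_x \sum_y phi (f x) (g y) * mu x * mu y = \sum_u \sum_v phi u v * nu u * nu v.
Proof.
move=> fmu gmu.
have fact (S : finType) (rho : fprob R S) (psi : S -> S -> R) :
    \sum_x \sum_y psi x y * rho x * rho y = \sum_x (\sum_y psi x y * rho y) * rho x.
  by apply: eq_bigr => x _; rewrite mulr_suml; apply: eq_bigr => y _; rewrite mulrAC.
rewrite !fact -(fmu (fun u => \sum_v phi u v * nu v)).
by apply: eq_bigr => x _; rewrite gmu.
Qed.

End Laws.

(** * Comparison of the costs *)

Section Costs.
Context {R : realType}.
Variables (k : fieldType) (d : nat) (F G : WFil R) (x : @mor (WFil R) F G).
Let f := wfil_galois x.

Let distort (q1 q2 : fidx F) : R :=
  `| `|val q1 - val q2| - `|val (gfun f q1) - val (gfun f q2)| |.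

(** A monotone [f] preserves the sign of a difference. *)
Lemma distortE q1 q2 :
  distort q1 q2 = `|(val q1 - val q2) - (val (gfun f q1) - val (gfun f q2))|.
Proof.
have fle q q' : q <= q' -> val (gfun f q) <= val (gfun f q') by apply: (gfun_homo f).
rewrite /distort; case: (leP q1 q2) => [le|/ltW le]; have := fle _ _ le;
  have {le}: val _ <= val _ := le => le fle'.
  rewrite (@ler0_norm _ (val q1 - val q2)) ?(@ler0_norm _ (val _ - _)) ?subr_le0 //.
  by rewrite -opprD normrN.
by rewrite (@ger0_norm _ (val q1 - val q2)) ?(@ger0_norm _ (val _ - _)) ?subr_ge0.
Qed.

(** The endpoints of a flipped pair are its members, so each entry of the
    displacement is a distortion, whichever way the two pairs are sorted. *)
Lemma dpl_flip_ind (P : R -> Prop) (p q : fidx F * fidx F) :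
  P (distort p.1 q.1) -> P (distort p.1 q.2) ->
  P (distort p.2 q.1) -> P (distort p.2 q.2) ->
  P (dpl (flip p) (flip q) (galois_bar f (flip p)) (galois_bar f (flip q))).
Proof.
have Pmax (a b : R) : P a -> P b -> P (Num.max a b) by rewrite maxEle; case: ifP.
rewrite /dpl /galois_bar /ival_lo /ival_hi /= !distortE => P11 P12 P21 P22.
by apply: (Pmax); apply: (Pmax); case: (leP p.1 p.2) => _; case: (leP q.1 q.2).
Qed.

(** The four distortions that bound the displacement have the same double sum,
    because both coordinates of the product measure are distributed like the
    weight of [F]. *)
Lemma wPD_cost_fin (r : R) : 1 <= r ->
  wdgm_cost r%:E (wPD_mor k d x) <= 4 `^ r^-1 * wfil_cost r%:E x.
Proof.
move=> r1; rewrite /wdgm_cost /wfil_cost /lp_cost /= -/f.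
have r0 : 0 <= r^-1 by rewrite invr_ge0 (le_trans ler01).
have S0 : 0 <= \sum_q1 \sum_q2 distort q1 q2 `^ r * wgt F q1 * wgt F q2.
  by do 2!apply: sumr_ge0 => ? _; rewrite !mulr_ge0 ?powR_ge0 ?fprob_ge0.
rewrite -powRM ?ler0n //; apply: ge0_ler_powR => //; rewrite ?nnegrE ?mulr_ge0 //.
  by do 2!apply: sumr_ge0 => ? _; rewrite !mulr_ge0 ?powR_ge0 ?fprob_push_ge0.
pose mu2 := fprob_prod (wgt F) (wgt F).
rewrite -(has_law2 _ (has_law_push _ mu2) (has_law_push _ mu2)).
have law1 := has_law_fst (wgt F) (wgt F); have law2 := has_law_snd (wgt F) (wgt F).
pose dr q1 q2 := distort q1 q2 `^ r.
have -> : 4 * \sum_q1 \sum_q2 distort q1 q2 `^ r * wgt F q1 * wgt F q2 =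
    \sum_p \sum_q (dr p.1 q.1 + dr p.1 q.2 + dr p.2 q.1 + dr p.2 q.2) * mu2 p * mu2 q.
  under [RHS]eq_bigr do under eq_bigr do rewrite !mulrDl.
  under [RHS]eq_bigr do rewrite !big_split.
  rewrite !big_split /= (has_law2 dr law1 law1) (has_law2 dr law1 law2).
  by rewrite (has_law2 dr law2 law1) (has_law2 dr law2 law2) /dr; ring.
apply: ler_sum => p _; apply: ler_sum => q _.
rewrite 2?ler_wpM2r ?fprob_prod_ge0 //.
have dr0 q1 q2 : 0 <= dr q1 q2 by apply: powR_ge0.
move: (dr0 p.1 q.1) (dr0 p.1 q.2) (dr0 p.2 q.1) (dr0 p.2 q.2) => h11 h12 h21 h22.
by apply: (dpl_flip_ind (P := fun y => y `^ r <= _)); rewrite -/(dr _ _); lra.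
Qed.

Lemma wPD_cost_infty : wdgm_cost +oo%E (wPD_mor k d x) <= wfil_cost +oo%E x.
Proof.
rewrite /wdgm_cost /wfil_cost /lp_cost -/f -/distort /=.
have cost0 : 0 <= \big[Num.max/0]_q1 \big[Num.max/0]_q2 distort q1 q2.
  by apply: bigmax_ge_id.
apply: bigmax_le => // I _; apply: bigmax_le => // J _.
have flipE (K : ival (fidx F)) : K = flip (ival_lo K, ival_hi K).
  apply/val_inj; rewrite /= (min_idPl (ival_leP K)) (max_idPr (ival_leP K)).
  by rewrite /ival_lo /ival_hi /=; case: (ival_pair K).
have distort_le q1 q2 :
    distort q1 q2 <= \big[Num.max/0]_q1 \big[Num.max/0]_q2 distort q1 q2.
  apply: le_trans (le_bigmax _ _ q1).
  exact: (le_bigmax _ (distort q1) q2).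
rewrite (flipE I) (flipE J).
by apply: (dpl_flip_ind (P := fun y => y <= _)).
Qed.

Lemma wPD_cost (p : \bar R) : (1 <= p)%E ->
  wdgm_cost p (wPD_mor k d x) <= 4 `^ fine (p^-1)%E * wfil_cost p x.
Proof.
case: p => [r| |] //; rewrite ?lee_fin => p1.
  by rewrite inver gt_eqF ?(lt_le_trans ltr01) //; apply: wPD_cost_fin.
by rewrite invey /= powRr0 mul1r; apply: wPD_cost_infty.
Qed.

End Costs.

Theorem proposition5p2p9 (R : realType) (k : fieldType) (d : nat) :
  (exists Phi : @functor_on (WFil R) (WDgm R) (wPD k d),
     forall (F G : WFil R) (x : mor F G),
       wdgm_galois (functor_mor Phi x) = wfil_galois x) /\
  (forall p : \bar R, (1 <= p)%E ->
   forall F G : WFil R,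
     (edit_dist (wdgm_cost p) (wPD k d F) (wPD k d G)
      <= (4 `^ fine (p^-1)%E)%:E * edit_dist (wfil_cost p) F G)%E).
Proof.
split; first by exists (wPD_functor k d).
move=> p p1 F G; apply: (edit_dist_functor (Fm := wPD_mor k d)).
  by rewrite powR_gt0.
by move=> A B x; apply: wPD_cost.
Qed.
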